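(* Let $n\ge 1$, $\sigma>0$, and let $\mathcal{T}$ denote the set of $n\times n$ real lower triangular matrices. Let $\bar L\in\mathcal{T}$ and $\bar b\in\mathbb{R}^n$ satisfy $\|\bar L\|_{\max}\le 1$ and $\|\bar b\|_\infty\le 1$. Let $(L,b)\sim N_{\mathcal{T}}((\bar L,\bar b),\sigma^2\mathrm{Id})$, and let $\boldsymbol{c}(L,b)$ be the componentwise condition number of the pair $(L,b)$ for the problem of linear equation solving. Then, for every real number $t>n(n+1)$, $$\mathrm{Prob}\{\boldsymbol{c}(L,b)>t\}\;\le\;\left(\frac{1+\sigma}{\sigma}\right)\left(\frac{n^3(n+1)^2}{t-n(n+1)}\right)\sqrt{\frac{2}{\pi}},$$ and, for every $\beta>1$, $$\mathbb{E}\big(\log_\beta \boldsymbol{c}(L,b)\big)\;\le\;\log_\beta\left(\frac{1+\sigma}{\sigma}\right)+5\log_\beta(n)+\frac{2.65}{\ln\beta}.$$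
   Context: Norms: $\|A\|_{\max}=\max_{i,j}|a_{ij}|$ for a matrix $A=(a_{ij})$, and $\|b\|_\infty=\max_i|b_i|$. Random data: $(L,b)\sim N_{\mathcal{T}}((\bar L,\bar b),\sigma^2\mathrm{Id})$ means that the entries $l_{ij}$ with $i\ge j$ and the entries $b_i$ are independent Gaussian random variables with $l_{ij}\sim N(\bar l_{ij},\sigma^2)$ and $b_i\sim N(\bar b_i,\sigma^2)$, while $l_{ij}=0$ for $i<j$. Componentwise condition number: For $u,v\in\mathbb{R}^p$ let $\frac{u}{v}=(w_1,\dots,w_p)$ with $w_i=u_i/v_i$ if $v_i\ne 0$, $w_i=0$ if $u_i=v_i=0$, and $w_i=\infty$ otherwise. Put $d(u,v)=\left\|\frac{u-v}{v}\right\|_\infty\in[0,\infty]$; when finite, $d(u,v)=\min\{\nu\ge 0: |u_i-v_i|\le\nu|v_i| \text{ for all } i\}$. For $\delta>0$ let $\mathcal{S}(a,\delta)=\{x\in\mathbb{R}^p: d(x,a)\le\delta\}$. For a continuous map $F:\mathcal{D}\to\mathbb{R}^q$, $\mathcal{D}\subseteq\mathbb{R}^p$, and $a\in\mathcal{D}$, the componentwise condition number of $F$ at $a$ is $$\boldsymbol{c}^F(a)=\lim_{\delta\to 0}\ \sup_{x\in\mathcal{S}(a,\delta)\cap\mathcal{D},\ x\ne a}\frac{d(F(x),F(a))}{d(x,a)}\in[0,\infty].$$ Linear equation solving: for $A$ a nonsingular $n\times n$ real matrix and $b\in\mathbb{R}^n$ let $x=A^{-1}b$. For $1\le k\le n$,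 $\boldsymbol{c}_k(A,b)$ is the componentwise condition number at $(A,b)$ of the map $(A,b)\mapsto x_k$ (defined on pairs with $A$ nonsingular), and $\boldsymbol{c}(A,b)=\max_{1\le k\le n}\boldsymbol{c}_k(A,b)$. Note that if $(L,b)\sim N_{\mathcal{T}}((\bar L,\bar b),\sigma^2\mathrm{Id})$ with $\sigma>0$, then the random lower triangular matrix $L$ is nonsingular with probability one. *)

(* Defs.v *)
From mathcomp Require Export all_boot all_order all_algebra.
From mathcomp Require Export all_classical all_reals all_analysis.
Export Order.TTheory GRing.Theory Num.Theory.
Export numFieldNormedType.Exports.

#[export] Set Implicit Arguments.
#[export] Unset Strict Implicit.
#[export] Unset Printing Implicit Defensive.

Local Open Scope classical_set_scope.
Local Open Scope ring_scope.

(* R^p is represented by matrices of any format with p entries: the notions   *)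
(* below do not depend on how the coordinates are arranged.                   *)
Section Componentwise.
Variable R : realType.

(* u / v with the conventions 0 / 0 = 0 and u / 0 = +oo for u <> 0. *)
Definition ratio (u v : R) : \bar R :=
  if v != 0 then (u / v)%:E else if u == 0 then 0%E else +oo%E.

(* The maximum starts at 0, harmless since the values range in [0, +oo]. *)
Definition reldist m p (u v : 'M[R]_(m, p)) : \bar R :=
  \big[maxe/0%E]_(ij : 'I_m * 'I_p)
    `|ratio ((u - v) ij.1 ij.2) (v ij.1 ij.2)|%E.

Definition relball m p (a : 'M[R]_(m, p)) (delta : R) : set 'M[R]_(m, p) :=
  [set x | (reldist x a <= delta%:E)%E].

(* Meant for a \in D. The map F is total, but only its values on D are used.  *)
(* The quotient is that of \bar R: the denominator is positive and finite,    *)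
(* the numerator may be +oo. The supremum is nondecreasing in delta, so that  *)
(* the limit always exists in \bar R.                                         *)
Definition cond m p m' p' (F : 'M[R]_(m, p) -> 'M[R]_(m', p'))
    (D : set 'M[R]_(m, p)) (a : 'M[R]_(m, p)) : \bar R :=
  lim ((ereal_sup [set (reldist (F x) (F a) / reldist x a)%E |
          x in relball a delta `&` D `&` [set x | x <> a]])
       @[delta --> 0^'+]).

End Componentwise.

(* The data (A, b) is the augmented matrix row_mx A b. *)
Section LinearSolving.
Variables (R : realType) (n : nat).

Definition solve_dom : set 'M[R]_(n, n + 1) := [set M | lsubmx M \in unitmx].

Definition solve_coord (k : 'I_n) (M : 'M[R]_(n, n + 1)) : 'M[R]_(1, 1) :=
  row k (invmx (lsubmx M) *m rsubmx M).

Definition cond_coord (k : 'I_n) (A : 'M[R]_n) (b : 'cV[R]_n) : \bar R :=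
  cond (solve_coord k) solve_dom (row_mx A b).

(* Singular matrices lie outside the domain; the usual convention that they   *)
(* have condition number +oo makes the function total.                        *)
Definition cond_solve (A : 'M[R]_n) (b : 'cV[R]_n) : \bar R :=
  if A \in unitmx then \big[maxe/0%E]_(k < n) cond_coord k A b else +oo%E.

End LinearSolving.

Section RandomData.
Context d (T : measurableType d) (R : realType) (P : probability T R).

(* Laws are compared on Borel sets only: outside of them the values of both   *)
(* set functions are meaningless.                                             *)
Definition gaussian_rv (X : T -> R) (mean sigma : R) : Prop :=
  measurable_fun setT X /\
  forall B : set R, measurable B ->
    pushforward P X B = normal_prob mean sigma B.

Definition mutually_independent (I : finType) (X : I -> T -> R) : Prop :=
  forall (J : {set I}) (B : I -> set R), (forall i, measurable (B i)) ->
    P (\bigcap_(i in [set` J]) (X i @^-1` B i)) =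
    (\prod_(i in J) P (X i @^-1` B i))%E.

(* Positions of the random entries: (i, j) with j <= i in the matrix, and     *)
(* all the entries of the right-hand side.                                    *)
Definition entry (n : nat) : finType :=
  ({ij : 'I_n * 'I_n | (ij.2 <= ij.1)%N} + 'I_n)%type.

Definition entry_value (n : nat) (A : 'M[R]_n) (b : 'cV[R]_n) (e : entry n) :=
  match e with
  | inl ij => A (val ij).1 (val ij).2
  | inr i => b i 0
  end.

(* (L, b) ~ N_T((Lbar, bbar), sigma^2 Id) *)
Definition gaussian_triangular (n : nat) (L : T -> 'M[R]_n) (b : T -> 'cV[R]_n)
    (Lbar : 'M[R]_n) (bbar : 'cV[R]_n) (sigma : R) : Prop :=
  [/\ forall w, is_trig_mx (L w),
      forall e : entry n, gaussian_rv (fun w => entry_value (L w) (b w) e)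
                                      (entry_value Lbar bbar e) sigma
    & mutually_independent
        (fun (e : entry n) w => entry_value (L w) (b w) e)].

End RandomData.

Definition logb (R : realType) (beta x : R) : R := ln x / ln beta.

(* Extension of logb to [0, +oo], with values -oo at 0 and +oo at +oo. *)
Definition loge (R : realType) (beta : R) (x : \bar R) : \bar R :=
  (lne x / (ln beta)%:E)%E.

(* Main.v *)
Require Import Defs.
From mathcomp Require Import ring lra measurable_realfun.

(** Write B = A^-1 and x = B b. If (A', b') is another nonsingular system with
solution x', then x' - x = B ((b' - b) - (A' - A) x') holds exactly. Hence a
perturbation of relative size at most r in every entry moves x_k by at most
r (S_k + O(r)), where
   S_k = sum_i |B_ki b_i| + sum_ij |B_ki a_ij x_j|,
and a suitable choice of the signs of the perturbation moves x_k by at least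
r (S_k - O(r)). So the condition number of x_k is S_k / |x_k| when x_k <> 0
([cond_coord_neq0]). When x_k = 0 it is 0 or +oo, according to whether x_k
vanishes for all nearby data or not ([cond_coord_eq0], [cond_coord_infty]).
That case has probability zero, but it has to be decided in a measurable way,
because the probability of the event c > t is only meaningful if this event is
measurable; the solution of the comparison system decides it.

Let N = n (n + 1), the number of terms of S_k: one for each entry of the data.
For triangular A the term of a_kk is exactly |x_k|, since B_kk a_kk = 1.
Therefore c_k > t forces one of the N - 1 other terms to exceed s |x_k|, with
s = (t - 1) / (N - 1) ([cond_coord_gt_term]). Consider such a term, let X be
the entry of the data to which it belongs, and freeze all the other entries.
If X is on the right-hand side or strictly below the diagonal, then x_k is an
affine function p X + q of X and the term is |p X|. If X is on the diagonal,
then x_k is affine in 1 / X; after multiplication by X, x_k becomes p + q X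
and the term becomes p. In both cases the event confines X to an interval that
avoids 0 and whose length is at most 2 / (s - 1) times its distance to 0.
Because |x| times the Gaussian density at x is at most
(1 + sigma) / (sigma sqrt (2 pi)), such an interval has probability at most
((1 + sigma) / sigma) sqrt (2 / pi) / (s - 1), whatever the frozen entries are.
By independence the same bound holds for the term itself ([err_rhs_tail],
[err_mat_tail]). Summing over the terms and over k yields
   P (c > t) <= K / (t - N),
   K = ((1 + sigma) / sigma) sqrt (2 / pi) n (N - 1)^2  ([cond_solve_tail]),
which implies the first claim.

For the second claim put t0 = N + K. Then P (c > t0 e^u) <= e^-u for u >= 0, so
the positive part of ln (c / t0) is dominated by an exponential variable of
mean 1, and E (ln c) <= ln (N + K) + 1 ([integral_loge_tail]). Finally
N + K <= (57 / 16) ((1 + sigma) / sigma) n^5 and ln (57 / 16) <= 1.65. *)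

Local Open Scope classical_set_scope.
Local Open Scope ring_scope.

(** * Componentwise relative distance *)

Section RelativeDistance.
Variable R : realType.

Lemma abse_ratio_le (u v r : R) : 0 <= r ->
  (`|ratio u v| <= r%:E)%E = (`|u| <= r * `|v|).
Proof.
move=> r0; rewrite /ratio; case: (eqVneq v 0) => [->|v0] /=.
  rewrite normr0 mulr0 normr_le0; case: (eqVneq u 0) => [_|u0] /=.
    by rewrite normr0 lee_fin r0.
  by rewrite leye_eq.
by rewrite lee_fin normrM normfV ler_pdivrMr ?normr_gt0.
Qed.

(** For finite bounds the conventions on division by zero disappear: a zero entry
of [v] just has to stay zero. *)
Lemma reldist_le m p (u v : 'M[R]_(m, p)) (r : R) : 0 <= r ->
  (reldist u v <= r%:E)%E <->
  forall i j, `|u i j - v i j| <= r * `|v i j|.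
Proof.
move=> r0; rewrite /reldist; split => [/bigmax_leP[_ h] i j|h].
  by have := h (i, j) isT; rewrite abse_ratio_le//= !mxE.
apply/bigmax_leP; split; first by rewrite lee_fin.
by move=> [i j] _ /=; rewrite abse_ratio_le// !mxE.
Qed.

Lemma reldist_ge0 m p (u v : 'M[R]_(m, p)) : (0 <= reldist u v)%E.
Proof. by rewrite /reldist; exact: bigmax_ge_id. Qed.

Lemma reldist_gt0 m p (u v : 'M[R]_(m, p)) : u <> v -> (0 < reldist u v)%E.
Proof.
move=> uv; rewrite lt_neqAle reldist_ge0 andbT; apply/eqP => d0; apply: uv.
apply/matrixP => i j; apply/eqP; rewrite -subr_eq0 -normr_le0.
rewrite -(mul0r `|v i j|).
by apply: (proj1 (reldist_le u v (lexx 0))); rewrite -d0.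
Qed.

Lemma reldist11 (u v : 'M[R]_(1, 1)) :
  reldist u v = `|ratio (u 0 0 - v 0 0)%R (v 0 0)%R|%E.
Proof.
rewrite /reldist; apply/eqP; rewrite eq_le; apply/andP; split.
  apply/bigmax_leP; split => // -[i j] _ /=.
  by rewrite (ord1 i) (ord1 j) !mxE.
apply/bigmax_geP; right; exists (0, 0) => //=.
by rewrite !mxE.
Qed.

End RelativeDistance.

(** * Componentwise perturbation of a linear system *)

Section Perturbation.
Variables (R : realType) (n : nat).
Implicit Types (A : 'M[R]_n) (b : 'cV[R]_n).

(** The relative ball around [(A, b)], in coordinates: the form in which
perturbations are built and estimated below. *)
Definition near_data (r : R) A b A' b' :=
  (forall i j, `|A' i j - A i j| <= r * `|A i j|) /\
  (forall i, `|b' i 0 - b i 0| <= r * `|b i 0|).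

Lemma relball_row_mx (r : R) A b (M : 'M[R]_(n, n + 1)) : 0 <= r ->
  relball (row_mx A b) r M <-> near_data r A b (lsubmx M) (rsubmx M).
Proof.
move=> r0; rewrite /relball /= reldist_le//; split => [h|[hA hb] i j].
  split=> [i j|i].
    by have := h i (lshift 1 j); rewrite row_mxEl mxE.
  by have := h i (rshift n 0); rewrite row_mxEr mxE.
rewrite -(splitK j); case: (fintype.split j) => j' /=.
  by rewrite row_mxEl; have := hA i j'; rewrite mxE.
by rewrite row_mxEr (ord1 j'); have := hb i; rewrite mxE.
Qed.

Lemma invmx_mul_sub A A' b b' : A \in unitmx -> A' \in unitmx ->
  invmx A' *m b' - invmx A *m b =
  invmx A *m ((b' - b) - (A' - A) *m (invmx A' *m b')).
Proof.
move=> uA uA'; rewrite mulmxBl mulKVmx// opprB.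
by rewrite (addrC (b' - b)) addrA addrNK mulmxBr mulKmx.
Qed.

(** The contribution of the entry [b i 0] to the first-order change of the [k]-th
unknown, and likewise below for the entry [A i j]. *)
Definition err_rhs A b (k i : 'I_n) : R := invmx A k i * b i 0.

Definition err_mat A b (k i j : 'I_n) : R :=
  invmx A k i * A i j * (invmx A *m b) j 0.

Definition first_order A b (k : 'I_n) : R :=
  \sum_i `|err_rhs A b k i| + \sum_i \sum_j `|err_mat A b k i j|.

(** An exact identity, not a linearisation, because the perturbed solution stands on
the right: this is what makes the error terms explicit. *)
Lemma sol_subE A A' b b' (k : 'I_n) : A \in unitmx -> A' \in unitmx ->
  (invmx A' *m b') k 0 - (invmx A *m b) k 0 =
  \sum_i invmx A k i * (b' i 0 - b i 0) -
  \sum_i \sum_j invmx A k i * (A' i j - A i j) * (invmx A' *m b') j 0.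
Proof.
move=> uA uA'.
have -> : (invmx A' *m b') k 0 - (invmx A *m b) k 0 =
  (invmx A *m ((b' - b) - (A' - A) *m (invmx A' *m b'))) k 0.
  by rewrite -invmx_mul_sub// [RHS]mxE [X in _ = _ + X]mxE.
rewrite mxE -sumrB; apply: eq_bigr => i _.
have -> : ((b' - b) - (A' - A) *m (invmx A' *m b')) i 0 =
  b' i 0 - b i 0 - \sum_j (A' i j - A i j) * (invmx A' *m b') j 0.
  rewrite mxE [X in X + _]mxE [X in _ + X + _]mxE [X in _ + X = _]mxE mxE.
  by congr (_ - _); apply: eq_bigr => j _; rewrite !mxE.
rewrite mulrBr; congr (_ - _).
by rewrite mulr_sumr; apply: eq_bigr => j _; rewrite mulrA.
Qed.

Lemma sol_dev_le (r : R) A b A' b' k : 0 <= r -> A \in unitmx -> A' \in unitmx ->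
  near_data r A b A' b' ->
  `|(invmx A' *m b') k 0 - (invmx A *m b) k 0| <=
  r * (\sum_i `|err_rhs A b k i| +
       \sum_i \sum_j `|invmx A k i * A i j| * `|(invmx A' *m b') j 0|).
Proof.
move=> r0 uA uA' [hA hb]; rewrite sol_subE// mulrDr !mulr_sumr.
apply: le_trans (ler_normB _ _) _; apply: lerD.
  apply: le_trans (ler_norm_sum _ _ _) _; apply: ler_sum => i _.
  by rewrite /err_rhs !normrM mulrCA ler_wpM2l.
apply: le_trans (ler_norm_sum _ _ _) _; apply: ler_sum => i _.
apply: le_trans (ler_norm_sum _ _ _) _; rewrite mulr_sumr; apply: ler_sum => j _.
by rewrite !normrM !mulrA ler_wpM2r// -mulrA mulrCA ler_wpM2l.
Qed.

(** The bound of [sol_dev_le] still involves the perturbed solution; summing it over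
all coordinates and absorbing the deviation, whose coefficient [r * alpha] is at
most 1/2 for small [r], bounds the deviation by the data alone. *)
Lemma sol_lipschitz A b : A \in unitmx ->
  exists C r0 : R, [/\ 0 <= C, 0 < r0 & forall r A' b', 0 <= r -> r <= r0 ->
    A' \in unitmx -> near_data r A b A' b' ->
    forall j, `|(invmx A' *m b') j 0 - (invmx A *m b) j 0| <= C * r].
Proof.
move=> uA.
pose beta := \sum_j \sum_i `|err_rhs A b j i|.
pose alpha := \sum_j \sum_i \sum_l `|invmx A j i * A i l|.
pose X := \sum_l `|(invmx A *m b) l 0|.
have beta0 : 0 <= beta by do 2!(apply: sumr_ge0 => ? _).
have alpha0 : 0 <= alpha by do 3!(apply: sumr_ge0 => ? _).
have X0 : 0 <= X by apply: sumr_ge0.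
exists (2 * (beta + alpha * X)), (2 * (alpha + 1))^-1; split.
- by rewrite mulr_ge0 ?addr_ge0 ?mulr_ge0.
- by rewrite invr_gt0 mulr_gt0// ltr_wpDl.
move=> r A' b' r0 rle uA' hd j.
pose dev l := `|(invmx A' *m b') l 0 - (invmx A *m b) l 0|.
pose mu := \sum_l dev l.
have le_mu l : dev l <= mu.
  by rewrite /mu (bigD1 l)//= lerDl sumr_ge0// => *; exact: normr_ge0.
have x'le l : `|(invmx A' *m b') l 0| <= X + mu.
  rewrite -[X in `|X|](addrNK ((invmx A *m b) l 0)) addrC.
  apply: le_trans (ler_normD _ _) _; apply: lerD (le_mu l).
  by rewrite /X (bigD1 l)//= lerDl sumr_ge0.
have mule : mu <= r * (beta + alpha * (X + mu)).
  rewrite mulrDr /beta /alpha mulr_suml !mulr_sumr -big_split/=.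
  apply: ler_sum => l _; apply: le_trans (sol_dev_le _ r0 uA uA' hd) _.
  rewrite mulrDr lerD2l ler_wpM2l// mulr_suml; apply: ler_sum => i _.
  rewrite mulr_suml; apply: ler_sum => m _.
  by rewrite ler_wpM2l.
have ra : r * alpha <= 2^-1.
  have : r * (2 * (alpha + 1)) <= 1.
    by rewrite -ler_pdivlMr ?div1r// mulr_gt0// ltr_wpDl.
  by move=> h; nra.
have mu0 : 0 <= mu by apply: sumr_ge0 => *; exact: normr_ge0.
apply: le_trans (le_mu j) _.
by have := ler_wpM2r mu0 ra; nra.
Qed.

Lemma sol_first_order A b (k : 'I_n) : A \in unitmx ->
  exists C r0 : R, [/\ 0 <= C, 0 < r0 & forall r A' b', 0 <= r -> r <= r0 ->
    A' \in unitmx -> near_data r A b A' b' ->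
    `|(invmx A' *m b') k 0 - (invmx A *m b) k 0|
      <= r * (first_order A b k + C * r)].
Proof.
move=> uA; have [C [r0 [C0 r00 h]]] := sol_lipschitz b uA.
exists ((\sum_i \sum_j `|invmx A k i * A i j|) * C), r0; split => //.
  by rewrite mulr_ge0//; do 2!(apply: sumr_ge0 => ? _).
move=> r A' b' r_ge0 rle uA' hd.
apply: le_trans (sol_dev_le _ r_ge0 uA uA' hd) _.
rewrite ler_wpM2l// /first_order -addrA lerD2l.
rewrite -mulrA mulr_suml -big_split/=; apply: ler_sum => i _.
rewrite mulr_suml -big_split/=; apply: ler_sum => j _.
rewrite /err_mat [X in _ <= X + _]normrM -mulrDr ler_wpM2l//.
rewrite -[X in `|X| <= _](addrNK ((invmx A *m b) j 0)) addrC.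
by apply: le_trans (ler_normD _ _) _; rewrite lerD2l h.
Qed.

Lemma trig_unitmxE A : is_trig_mx A ->
  (A \in unitmx) = [forall i, A i i != 0].
Proof.
move=> tA; rewrite unitmxE det_trig// unitfE.
by apply/prodf_neq0/forallP => h i; last move=> _; exact: h.
Qed.

(** Relative perturbations keep zeros, and below relative size 1 they also keep
nonzero entries away from 0, so the diagonal entries stay nonzero. *)
Lemma near_data_trig r A b A' b' : is_trig_mx A -> A \in unitmx ->
  r < 1 -> near_data r A b A' b' -> is_trig_mx A' /\ A' \in unitmx.
Proof.
move=> tA uA r1 [hA _].
have tA' : is_trig_mx A'.
  apply/is_trig_mxP => i j ij; have := hA i j.
  have /is_trig_mxP/(_ i j ij)-> := tA.
  by rewrite normr0 mulr0 subr0 normr_le0 => /eqP.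
split => //; rewrite trig_unitmxE//; apply/forallP => i; apply/eqP => A'0.
move: uA; rewrite trig_unitmxE// => /forallP/(_ i); rewrite -normr_gt0 => a0.
have := hA i i; rewrite A'0 sub0r normrN; apply/negP; rewrite -ltNge.
by rewrite gtr_pMl.
Qed.

(** Each entry is moved in the direction in which its error term is positive, so
that all the first-order contributions add up. *)
Lemma sol_first_order_sharp A b (k : 'I_n) : is_trig_mx A -> A \in unitmx ->
  exists C r0 : R, [/\ 0 <= C, 0 < r0, r0 < 1 & forall r, 0 <= r -> r <= r0 ->
    exists A' b', [/\ A' \in unitmx, near_data r A b A' b' &
     r * (first_order A b k - C * r) <=
      (invmx A' *m b') k 0 - (invmx A *m b) k 0]].
Proof.
move=> tA uA; have [C [r0 [C0 r00 h]]] := sol_lipschitz b uA.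
exists ((\sum_i \sum_j `|invmx A k i * A i j|) * C), (Num.min r0 2^-1); split => //.
- by rewrite mulr_ge0//; do 2!(apply: sumr_ge0 => ? _).
- by rewrite lt_min r00/= invr_gt0.
- by rewrite gt_min; apply/orP; right; lra.
move=> r r_ge0; rewrite le_min => /andP[rle r2].
pose A' : 'M[R]_n := \matrix_(i, j) (A i j - r * Num.sg (err_mat A b k i j) * A i j).
pose b' : 'cV[R]_n := \col_i (b i 0 + r * Num.sg (err_rhs A b k i) * b i 0).
have hd : near_data r A b A' b'.
  split => [i j|i].
    rewrite mxE addrAC addrN sub0r normrN !normrM (ger0_norm r_ge0) -mulrA ler_wpM2l//.
    by rewrite ler_piMl// normr_sg lern1 leq_b1.
  rewrite mxE addrAC addrN add0r !normrM (ger0_norm r_ge0) -mulrA ler_wpM2l//.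
  by rewrite ler_piMl// normr_sg lern1 leq_b1.
have [tA' uA'] : is_trig_mx A' /\ A' \in unitmx.
  by apply: near_data_trig tA uA _ hd; lra.
exists A', b'; split => //.
rewrite sol_subE// -sumrN /first_order mulrBr mulrDr -addrA !mulr_sumr.
apply: lerD.
  apply: ler_sum => i _; rewrite mxE addrAC addrN add0r.
  rewrite [X in _ <= X](_ : _ = r * (Num.sg (err_rhs A b k i) * err_rhs A b k i)).
    by rewrite -normrEsg.
  by rewrite /err_rhs; ring.
rewrite -[X in r * X]mulrA mulr_suml mulr_sumr -sumrB.
apply: ler_sum => i _; rewrite mulr_suml !mulr_sumr -sumrB -sumrN.
apply: ler_sum => j _; rewrite mxE addrAC addrN add0r.
set B := invmx A k i; set x := (invmx A *m b) j 0; set x' := (invmx A' *m b') j 0.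
have dx : `|x' - x| <= C * r by exact: h.
have -> : - (B * - (r * Num.sg (err_mat A b k i j) * A i j) * x') =
    r * (`|err_mat A b k i j| + Num.sg (err_mat A b k i j) * (B * A i j * (x' - x))).
  by rewrite [`|_|]normrEsg {3}/err_mat -/B -/x; ring.
rewrite -mulrBr ler_wpM2l// lerD2l lerNl -mulrN.
apply: le_trans (ler_norm _) _; rewrite normrM normrN.
apply: le_trans (ler_wpM2l (normr_ge0 _) dx); rewrite normrM.
by rewrite ler_piMl ?mulr_ge0// normr_sg lern1 leq_b1.
Qed.

End Perturbation.

(** * Triangular systems *)

Section Triangular.
Variables (R : realType) (n : nat).
Implicit Types (A : 'M[R]_n) (b : 'cV[R]_n).

Lemma mulmx_trig A m (M : 'M[R]_(n, m)) i j : is_trig_mx A ->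
  (A *m M) i j = A i i * M i j + \sum_(l < n | (l < i)%N) A i l * M l j.
Proof.
move=> /is_trig_mxP tA; rewrite mxE (bigD1 i)//=; congr (_ + _).
rewrite (bigID (fun l : 'I_n => (l < i)%N))/= [X in _ + X]big1 ?addr0.
  by apply: eq_bigl => l; rewrite andb_idl// => /ltn_eqF/negbT; rewrite val_eqE.
move=> l /andP[li].
rewrite -leqNgt leq_eqVlt val_eqE eq_sym (negPf li)/= => il.
by rewrite tA ?mul0r.
Qed.

Lemma trig_diag_neq0 A i : is_trig_mx A -> A \in unitmx -> A i i != 0.
Proof. by move=> tA; rewrite trig_unitmxE// => /forallP. Qed.

Lemma invmx_trig A (i j : 'I_n) : is_trig_mx A -> A \in unitmx -> (i < j)%N -> invmx A i j = 0.
Proof.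
move=> tA uA.
have [m] := ubnP (i : nat); elim: m i => // m IH i; rewrite ltnS => im ij.
have /matrixP/(_ i j) := mulmxV uA.
rewrite mulmx_trig// big1 => [|l li]; last first.
  by rewrite IH ?mulr0//; [exact: leq_trans li im|exact: ltn_trans ij].
rewrite addr0 mxE -val_eqE/= ltn_eqF// => /eqP.
by rewrite mulf_eq0 (negPf (trig_diag_neq0 i tA uA)) => /eqP.
Qed.

Lemma invmx_trig_diag A i : is_trig_mx A -> A \in unitmx -> A i i * invmx A i i = 1.
Proof.
move=> tA uA; have /matrixP/(_ i i) := mulmxV uA.
rewrite mulmx_trig// big1 => [|l li]; last by rewrite invmx_trig ?mulr0.
by rewrite addr0 mxE eqxx.
Qed.

Lemma invmx_trig_diag_neq0 A i : is_trig_mx A -> A \in unitmx -> invmx A i i != 0.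
Proof.
move=> tA uA; apply/eqP => h; have := invmx_trig_diag i tA uA.
by rewrite h mulr0 => /esym/eqP; rewrite oner_eq0.
Qed.

(** The perturbed solution occurs on both sides, but only through its [j]-th
coordinate; for a triangular system that coordinate does not depend on the rows
below the [j]-th, which makes the formula explicit. *)
Lemma sol_update_mat A b (i j k : 'I_n) c : A \in unitmx ->
  A + c *: delta_mx i j \in unitmx ->
  (invmx (A + c *: delta_mx i j) *m b) k 0 =
  (invmx A *m b) k 0
    - invmx A k i * c * (invmx (A + c *: delta_mx i j) *m b) j 0.
Proof.
move=> uA uA'; apply/eqP; rewrite [X in _ == X]addrC -subr_eq; apply/eqP.
rewrite sol_subE// big1 ?sub0r => [|l _]; last by rewrite subrr mulr0.
congr (- _); rewrite (bigD1 i)//= (bigD1 j)//= big1 => [|l lj]; last first.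
  by rewrite !mxE eqxx (negPf lj) mulr0 addrAC subrr add0r mulr0 mul0r.
rewrite addr0 big1 ?addr0 => [|m mi].
  by rewrite !mxE !eqxx mulr1 addrAC subrr add0r.
by rewrite big1// => l _; rewrite !mxE (negPf mi) mulr0 addrAC subrr add0r mulr0 mul0r.
Qed.

Lemma sol_update_rhs A b (i k : 'I_n) c : A \in unitmx ->
  (invmx A *m (b + c *: delta_mx i 0)) k 0 =
  (invmx A *m b) k 0 + invmx A k i * c.
Proof.
move=> uA; apply/eqP; rewrite [X in _ == X]addrC -subr_eq; apply/eqP.
rewrite sol_subE// [X in _ - X]big1 ?subr0 => [|l _]; last first.
  by rewrite big1// => m _; rewrite subrr mulr0 mul0r.
rewrite (bigD1 i)//= big1 => [|l li].
  by rewrite !mxE !eqxx mulr1 addrAC subrr add0r addr0.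
by rewrite !mxE (negPf li) mulr0 addrAC subrr add0r mulr0.
Qed.

Lemma near_data_trans r s t A b A' b' A'' b'' : 0 <= s -> r + s + s * r <= t ->
  near_data r A b A' b' -> near_data s A' b' A'' b'' -> near_data t A b A'' b''.
Proof.
move=> s0 rst [hA hb] [hA' hb'].
have step x y z : `|y - x| <= r * `|x| -> `|z - y| <= s * `|y| -> `|z - x| <= t * `|x|.
  move=> xy yz.
  have yx : `|y| <= `|y - x| + `|x| by rewrite -{1}(subrK x y) ler_normD.
  have zx : `|z - x| <= `|z - y| + `|y - x|.
    by rewrite -{1}(subrK y z) -addrA ler_normD.
  have := normr_ge0 x; nra.
by split=> [i j|i]; [apply: step (hA i j) (hA' i j)|apply: step (hb i) (hb' i)].
Qed.

Lemma near_data_refl r A b : 0 <= r -> near_data r A b A b.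
Proof. by move=> r0; split=> *; rewrite subrr normr0 mulr_ge0. Qed.

Definition comparison_mx A : 'M[R]_n :=
  \matrix_(i, j) if i == j then `|A i j| else - `|A i j|.

(** The comparison matrix has all signs chosen so that forward substitution never
cancels: the [k]-th coordinate of its solution vanishes exactly when the unknown
[k] vanishes for all nearby data. As a function of the data it is visibly
measurable. *)
Definition comparison_sol A b : 'cV[R]_n :=
  invmx (comparison_mx A) *m map_mx Num.norm b.

Lemma comparison_trig A : is_trig_mx A -> is_trig_mx (comparison_mx A).
Proof.
move=> /is_trig_mxP tA; apply/is_trig_mxP => i j ij.
by rewrite mxE -val_eqE/= ltn_eqF// tA// normr0 oppr0.
Qed.

Lemma comparison_unit A : is_trig_mx A -> A \in unitmx ->
  comparison_mx A \in unitmx.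
Proof.
move=> tA uA; rewrite trig_unitmxE ?comparison_trig//; apply/forallP => i.
by rewrite mxE eqxx normr_eq0 trig_diag_neq0.
Qed.

Lemma comparison_solE A b k : is_trig_mx A -> A \in unitmx ->
  `|A k k| * comparison_sol A b k 0 =
  `|b k 0| + \sum_(j < n | (j < k)%N) `|A k j| * comparison_sol A b j 0.
Proof.
move=> tA uA.
have : comparison_mx A *m comparison_sol A b = map_mx Num.norm b.
  by rewrite mulKVmx ?comparison_unit.
move=> /matrixP/(_ k 0).
rewrite mulmx_trig ?comparison_trig// [map_mx _ _ _ _]mxE => <-.
rewrite [comparison_mx A k k]mxE eqxx -addrA -big_split/=.
rewrite big1 ?addr0// => j jk.
by rewrite mxE -val_eqE/= gtn_eqF// mulNr addNr.
Qed.

Lemma comparison_sol_ge0 A b k : is_trig_mx A -> A \in unitmx -> 0 <= comparison_sol A b k 0.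
Proof.
move=> tA uA.
have [m] := ubnP (k : nat); elim: m k => // m IH k; rewrite ltnS => km.
rewrite -(pmulr_rge0 _ (_ : 0 < `|A k k|)) ?normr_gt0 ?trig_diag_neq0//.
rewrite comparison_solE// addr_ge0// sumr_ge0// => j jk.
by rewrite mulr_ge0// IH// (leq_trans jk).
Qed.

Lemma comparison_sol_eq0 A b k : is_trig_mx A -> A \in unitmx ->
  (comparison_sol A b k 0 == 0) =
  (b k 0 == 0) && [forall j : 'I_n, (j < k)%N ==> (A k j == 0) || (comparison_sol A b j 0 == 0)].
Proof.
move=> tA uA.
have -> : (comparison_sol A b k 0 == 0) = (`|A k k| * comparison_sol A b k 0 == 0).
  by rewrite mulf_eq0 normr_eq0 (negPf (trig_diag_neq0 k tA uA)).
rewrite comparison_solE// paddr_eq0//; last first.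
  by apply: sumr_ge0 => j _; rewrite mulr_ge0 ?comparison_sol_ge0.
rewrite normr_eq0; congr (_ && _).
rewrite psumr_eq0 => [|j _]; last by rewrite mulr_ge0 ?comparison_sol_ge0.
apply/allP/forallP => [h j|h j _].
  apply/implyP => jk; have := h j; rewrite mem_index_enum jk mulf_eq0 normr_eq0.
  by apply.
by apply/implyP => jk; have := h j; rewrite jk mulf_eq0 normr_eq0.
Qed.

(** Along forward substitution every contribution to the unknown [k] contains a
factor that is zero, and remains so under relative perturbations. *)
Lemma near_sol_eq0 A b k r A' b' : is_trig_mx A -> A \in unitmx ->
  r < 1 -> near_data r A b A' b' -> comparison_sol A b k 0 = 0 ->
  (invmx A' *m b') k 0 = 0.
Proof.
move=> tA uA r1 hd; have [tA' uA'] := near_data_trig tA uA r1 hd.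
have [hA hb] := hd.
have [m] := ubnP (k : nat); elim: m k => // m IH k; rewrite ltnS => km.
move=> /eqP; rewrite comparison_sol_eq0// => /andP[/eqP bk /forallP h].
have b'k : b' k 0 = 0.
  by have := hb k; rewrite bk normr0 mulr0 subr0 normr_le0 => /eqP.
have := mulmx_trig (invmx A' *m b') k 0 tA'.
rewrite mulKVmx// b'k big1 ?addr0 => [/esym/eqP|j jk].
  by rewrite mulf_eq0 (negPf (trig_diag_neq0 k tA' uA')) => /eqP.
have := h j; rewrite jk/= => /orP[/eqP akj|/eqP yj].
  suff -> : A' k j = 0 by rewrite mul0r.
  by have := hA k j; rewrite akj normr0 mulr0 subr0 normr_le0 => /eqP.
by rewrite (IH j) ?mulr0// (leq_trans jk).
Qed.

(** By induction along forward substitution: either [b k 0] contributes, or some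
[A k j] multiplies an unknown [j] that can be made nonzero nearby. If the unknown
[k] still vanishes there, a further change of that single entry moves it. *)
Lemma near_sol_neq0 A b k r : is_trig_mx A -> A \in unitmx ->
  0 < r -> r < 1 -> comparison_sol A b k 0 != 0 ->
  exists A' b', [/\ A' \in unitmx, near_data r A b A' b' &
    (invmx A' *m b') k 0 != 0].
Proof.
move=> tA uA.
have [m] := ubnP (k : nat); elim: m k r => // m IH k r; rewrite ltnS => km r0 r1.
rewrite comparison_sol_eq0// negb_and => /orP[bk|/forallPn[j]].
  have [xk|xk] := eqVneq ((invmx A *m b) k 0) 0; last first.
    by exists A, b; split => //; exact: near_data_refl (ltW r0).
  exists A, (b + (r * b k 0) *: delta_mx k 0); split => //.
    split=> [i j|i]; first by rewrite subrr normr0 mulr_ge0// ltW.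
    rewrite !mxE eqxx andbT addrAC subrr add0r.
    have [->|_] := eqVneq i k; last by rewrite mulr0 normr0 mulr_ge0// ltW.
    by rewrite /= mulr1 normrM gtr0_norm.
  rewrite sol_update_rhs// xk add0r.
  by rewrite !mulf_eq0 !negb_or invmx_trig_diag_neq0// bk (gt_eqF r0).
rewrite negb_imply negb_or => /and3P[jk akj yj].
(* Two successive perturbations of size s must stay within r. *)
have [s [s0 s1 srs]] : exists s : R, [/\ 0 < s, s < 1 & s + s + s * s <= r].
  by exists (r / 3); split; [lra|lra|nra].
have [A' [b' [uA' hd xj]]] := IH j s (leq_trans jk km) s0 s1 yj.
have [tA' _] := near_data_trig tA uA s1 hd.
have [xk|xk] := eqVneq ((invmx A' *m b') k 0) 0; last first.
  exists A', b'; split => //.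
  apply: near_data_trans hd (near_data_refl _ _ (lexx 0)) => //.
  by rewrite mul0r !addr0; nra.
have hd' : near_data s A' b' (A' + (s * A' k j) *: delta_mx k j) b'.
  split=> [i l|i]; last by rewrite subrr normr0 mulr_ge0// ltW.
  rewrite !mxE addrAC subrr add0r.
  have [->|_] := eqVneq i k; last by rewrite mulr0 normr0 mulr_ge0// ltW.
  have [->|_] := eqVneq l j; last by rewrite mulr0 normr0 mulr_ge0// ltW.
  by rewrite /= mulr1 normrM gtr0_norm.
have [tA'' uA''] := near_data_trig tA' uA' s1 hd'.
exists (A' + (s * A' k j) *: delta_mx k j), b'; split => //.
  exact: near_data_trans (ltW s0) srs hd hd'.
have A'kj : A' k j != 0.
  apply/eqP => a0; have := hd.1 k j; rewrite a0 sub0r normrN; apply/negP.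
  by rewrite -ltNge gtr_pMl// normr_gt0.
rewrite sol_update_mat// xk add0r oppr_eq0.
rewrite !mulf_eq0 !negb_or invmx_trig_diag_neq0// A'kj (gt_eqF s0)/=.
by rewrite sol_update_mat// invmx_trig// !mul0r subr0.
Qed.

End Triangular.

(** * The condition number in closed form *)

Section CondFormula.
Variables (R : realType) (n : nat).
Implicit Types (A : 'M[R]_n) (b : 'cV[R]_n) (k : 'I_n).

Definition sol_quotients A b k (delta : R) : set \bar R :=
  [set (reldist (solve_coord k M) (solve_coord k (row_mx A b)) /
        reldist M (row_mx A b))%E | M in
    relball (row_mx A b) delta `&` @solve_dom R n `&` [set M | M <> row_mx A b]].

Lemma solve_coordE k (M : 'M[R]_(n, n + 1)) :
  solve_coord k M 0 0 = (invmx (lsubmx M) *m rsubmx M) k 0.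
Proof. by rewrite /solve_coord mxE. Qed.

Lemma relball_near_data A b r A' b' : 0 <= r -> near_data r A b A' b' ->
  relball (row_mx A b) r (row_mx A' b').
Proof. by move=> r0 hd; apply/relball_row_mx; rewrite ?row_mxKl ?row_mxKr. Qed.

(** The denominator of a quotient is a positive real number, and it is itself a
valid radius: estimates may use it instead of [delta]. *)
Lemma relball_exact A b delta (M : 'M[R]_(n, n + 1)) : 0 <= delta ->
  relball (row_mx A b) delta M -> M <> row_mx A b ->
  exists r, [/\ reldist M (row_mx A b) = r%:E, 0 < r, r <= delta &
    near_data r A b (lsubmx M) (rsubmx M)].
Proof.
move=> d0 Md Ma; have := reldist_gt0 Ma; move: (Md); rewrite /relball/=.
case E : (reldist M (row_mx A b)) => [r| |]//; rewrite !lee_fin lte_fin => rd r0.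
exists r; split => //; apply/relball_row_mx; first exact: ltW.
by rewrite /relball /= E.
Qed.

Lemma sol_quotient_neq0 A b k (M : 'M[R]_(n, n + 1)) r :
  (invmx A *m b) k 0 != 0 -> 0 < r -> reldist M (row_mx A b) = r%:E ->
  (reldist (solve_coord k M) (solve_coord k (row_mx A b)) /
    reldist M (row_mx A b))%E =
  (`|(invmx (lsubmx M) *m rsubmx M) k 0 - (invmx A *m b) k 0| /
     `|(invmx A *m b) k 0| / r)%:E.
Proof.
move=> xk r0 ->; rewrite reldist11 !solve_coordE row_mxKl row_mxKr.
by rewrite /ratio xk inver gt_eqF// abse_EFin normrM normfV -EFinM.
Qed.

Lemma sol_quotients_member A b k delta A' b' : 0 < delta -> A' \in unitmx ->
  near_data delta A b A' b' -> row_mx A' b' <> row_mx A b ->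
  sol_quotients A b k delta
    (reldist (solve_coord k (row_mx A' b')) (solve_coord k (row_mx A b)) /
     reldist (row_mx A' b') (row_mx A b))%E.
Proof.
move=> d0 uA' hd ne; exists (row_mx A' b') => //; split; last by [].
split; first exact: relball_near_data (ltW d0) hd.
by rewrite /solve_dom/= row_mxKl.
Qed.

(** The supremum over the ball of radius [d] lies between [(S - C2 d) / |x|] and
[(S + C1 d) / |x|], by the two first-order lemmas. *)
Lemma cond_coord_neq0 A b k : is_trig_mx A -> A \in unitmx ->
  (invmx A *m b) k 0 != 0 ->
  cond_coord k A b = (first_order A b k / `|(invmx A *m b) k 0|)%:E.
Proof.
move=> tA uA xk; set x := (invmx A *m b) k 0 in xk *.
have x0 : 0 < `|x| by rewrite normr_gt0.
have [C1 [r1 [C10 r10 up]]] := sol_first_order b k uA.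
have [C2 [r2 [C20 r20 r21 lo]]] := sol_first_order_sharp b k tA uA.
have S0 : 0 < first_order A b k.
  apply: lt_le_trans x0 _; rewrite /x mxE.
  apply: le_trans (ler_norm_sum _ _ _) _.
  rewrite /first_order lerDl; do 2!(apply: sumr_ge0 => ? _).
  by [].
set S := first_order A b k in up lo S0 *.
have lim_affine (c : R) :
    ((S + c * d) / `|x|)%:E @[d --> 0^'+] --> (S / `|x|)%:E.
  apply/cvg_EFin; first exact: nearW.
  have -> : S / `|x| = (S + c * 0) / `|x| by rewrite mulr0 addr0.
  apply: cvg_at_right_filter; apply: cvgMl; apply: cvgD; first exact: cvg_cst.
  by apply: cvgMr; exact: cvg_id.
rewrite /cond_coord /cond; apply: cvg_lim => //.
apply: (@squeeze_cvge _ _ _ R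
  (fun d => ((S - C2 * d) / `|x|)%:E) _ (fun d => ((S + C1 * d) / `|x|)%:E)).
- near=> d.
  have d0 : 0 < d by near: d; exact: nbhs_right_gt.
  have d1 : d <= r1 by near: d; exact: nbhs_right_le.
  have d2 : d <= r2 by near: d; exact: nbhs_right_le.
  have dS : 0 < S - C2 * d.
    have C21 : 0 < C2 + 1 by rewrite ltr_wpDl.
    have : d < S / (C2 + 1) by near: d; apply: nbhs_right_lt; rewrite divr_gt0// ltr_wpDl.
    by rewrite ltr_pdivlMr// mulrDr mulr1 mulrC => dS; lra.
  apply/andP; split.
    have [A' [b' [uA' hd h]]] := lo d (ltW d0) d2.
    have ne : row_mx A' b' <> row_mx A b.
      move=> /eq_row_mx[AA bb]; move: h; rewrite AA bb subrr; apply/negP.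
      by rewrite -ltNge mulr_gt0.
    apply: le_trans (ereal_sup_ubound (sol_quotients_member k d0 uA' hd ne)).
    have [r [rE r0 rd _]] :=
      relball_exact (ltW d0) (relball_near_data (ltW d0) hd) ne.
    rewrite (sol_quotient_neq0 xk r0 rE) row_mxKl row_mxKr lee_fin -/x.
    rewrite mulrAC ler_wpM2r ?invr_ge0// ler_pdivlMr//.
    apply: le_trans (ler_norm _); apply: le_trans h.
    by rewrite mulrC ler_wpM2r// ltW.
  apply: ge_ereal_sup => _ [M [[Md MD] Ma] <-].
  have [r [rE r0 rd hd]] := relball_exact (ltW d0) Md Ma.
  rewrite (sol_quotient_neq0 xk r0 rE) lee_fin -/x mulrAC.
  rewrite ler_wpM2r ?invr_ge0// ler_pdivrMr// mulrC.
  apply: le_trans (up r _ _ (ltW r0) (le_trans rd d1) MD hd) _.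
  by rewrite (ler_wpM2l (ltW r0))// lerD2l ler_wpM2l.
- by under eq_fun do rewrite -mulNr; exact: lim_affine.
- exact: lim_affine.
Unshelve. all: by end_near.
Qed.

(** All quotients are 0, and there are some: scaling [A] gives a point of the ball
other than its centre. *)
Lemma cond_coord_eq0 A b k : is_trig_mx A -> A \in unitmx ->
  (invmx A *m b) k 0 = 0 -> comparison_sol A b k 0 = 0 ->
  cond_coord k A b = 0%E.
Proof.
move=> tA uA xk yk; rewrite /cond_coord /cond; apply: cvg_lim => //.
apply: cvg_near_cst; near=> d.
have d0 : 0 < d by near: d; exact: nbhs_right_gt.
have d1 : d < 1 by near: d; exact: nbhs_right_lt.
have q0 M : relball (row_mx A b) d M -> M <> row_mx A b ->
    (reldist (solve_coord k M) (solve_coord k (row_mx A b)) /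
        reldist M (row_mx A b))%E = 0%E.
  move=> Md Ma; have [r [-> r0 rd hd]] := relball_exact (ltW d0) Md Ma.
  rewrite reldist11 !solve_coordE row_mxKl row_mxKr xk subr0.
  rewrite (near_sol_eq0 tA uA _ hd yk) ?(le_lt_trans rd)//.
  by rewrite /ratio eqxx /= normr0 mul0e.
apply/eqP; rewrite eq_le; apply/andP; split.
  by apply: ge_ereal_sup => _ [M [[Md MD] Ma] <-]; rewrite q0.
have uA' : (1 + d) *: A \in unitmx by rewrite unitmxZ// unitfE gt_eqF// addr_gt0.
have ne : row_mx ((1 + d) *: A) b <> row_mx A b.
  move=> /eq_row_mx[/matrixP/(_ k k)] /eqP; rewrite mxE mulrDl mul1r.
  rewrite -subr_eq0 addrAC subrr add0r mulf_eq0 gt_eqF//=.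
  by rewrite (negPf (trig_diag_neq0 k tA uA)).
have hd : near_data d A b ((1 + d) *: A) b.
  split=> [i j|i]; last by rewrite subrr normr0 mulr_ge0// ltW.
  by rewrite mxE mulrDl mul1r addrAC subrr add0r normrM gtr0_norm.
have qm := sol_quotients_member k d0 uA' hd ne.
apply: le_trans (ereal_sup_ubound qm); rewrite q0//.
exact: relball_near_data (ltW d0) hd.
Unshelve. all: by end_near.
Qed.

(** Every ball contains data whose unknown [k] is nonzero; its relative distance to
0 is +oo. *)
Lemma cond_coord_infty A b k : is_trig_mx A -> A \in unitmx ->
  (invmx A *m b) k 0 = 0 -> comparison_sol A b k 0 != 0 ->
  cond_coord k A b = +oo%E.
Proof.
move=> tA uA xk yk; rewrite /cond_coord /cond; apply: cvg_lim => //.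
apply: cvg_near_cst; near=> d.
have d0 : 0 < d by near: d; exact: nbhs_right_gt.
have d1 : d < 1 by near: d; exact: nbhs_right_lt.
apply/eqP; rewrite -leye_eq.
have [A' [b' [uA' hd x'k]]] := near_sol_neq0 tA uA d0 d1 yk.
have ne : row_mx A' b' <> row_mx A b.
  by move=> /eq_row_mx[AA bb]; move: x'k; rewrite AA bb xk eqxx.
apply: le_trans (ereal_sup_ubound (sol_quotients_member k d0 uA' hd ne)).
have [r [-> r0 _ _]] :=
  relball_exact (ltW d0) (relball_near_data (ltW d0) hd) ne.
rewrite reldist11 !solve_coordE !row_mxKl !row_mxKr xk subr0 /ratio eqxx/= (negPf x'k).
by rewrite inver gt_eqF//= gt0_mulye// lte_fin invr_gt0.
Unshelve. all: by end_near.
Qed.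

Lemma cond_coordE A b k :
  is_trig_mx A -> A \in unitmx ->
  cond_coord k A b =
  if (invmx A *m b) k 0 == 0
  then if comparison_sol A b k 0 == 0 then 0%E else +oo%E
  else (first_order A b k / `|(invmx A *m b) k 0|)%:E.
Proof.
move=> tA uA; case: eqVneq => xk; last exact: cond_coord_neq0.
case: eqVneq => yk; first exact: cond_coord_eq0.
exact: cond_coord_infty.
Qed.

End CondFormula.

(** * Measurability *)

Section Measurability.
Context d (T : measurableType d) (R : realType).

Lemma measurable_funVr (f : T -> R) :
  measurable_fun setT f -> measurable_fun setT (fun w => (f w)^-1).
Proof.
move=> mf; have inv_meas : measurable_fun setT (fun x : R => x^-1).
  rewrite (_ : (fun _ => _) = (fun x : R => if x == 0 then 0 else x^-1)); last first.
    by apply/funext => x; case: eqVneq => // ->; rewrite invr0.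
  apply: measurable_fun_if => //.
  - by apply: measurable_fun_eqr.
  - rewrite setTI (_ : _ @^-1` _ = [set x : R | x != 0]); last first.
      by apply/seteqP; split => x /=; case: eqP.
    apply: open_continuous_measurable_fun; first exact: open_neq.
    by move=> x /[!inE] /= x0; exact: inv_continuous.
exact: measurableT_comp inv_meas mf.
Qed.

Lemma measurable_lt_set (f g : T -> R) :
  measurable_fun setT f -> measurable_fun setT g ->
  measurable [set w | f w < g w].
Proof.
move=> mf mg; rewrite -[X in measurable X]setTI.
by have := measurable_fun_ltr mf mg => /(_ measurableT [set true]); apply.
Qed.

Definition measurable_mx m p (A : T -> 'M[R]_(m, p)) :=
  forall i j, measurable_fun setT (fun w => A w i j).

Lemma measurable_mulmx m p q (A : T -> 'M[R]_(m, p)) (B : T -> 'M[R]_(p, q)) :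
  measurable_mx A -> measurable_mx B -> measurable_mx (fun w => A w *m B w).
Proof.
move=> mA mB i j; under eq_fun do rewrite mxE.
by apply: measurable_sum => k; exact: measurable_funM.
Qed.

Lemma measurable_det n (A : T -> 'M[R]_n) :
  measurable_mx A -> measurable_fun setT (fun w => \det (A w)).
Proof.
move=> mA; rewrite /determinant; apply: measurable_sum => s.
apply: measurable_funM => //; apply: measurable_prod => i _; exact: mA.
Qed.

Lemma measurable_fun_unitmx n (A : T -> 'M[R]_n) :
  measurable_mx A -> measurable_fun setT (fun w => A w \in unitmx).
Proof.
move=> mA; under eq_fun do rewrite unitmxE unitfE.
by apply: measurable_neg; apply: measurable_fun_eqr => //; exact: measurable_det.
Qed.

(** Cramer's rule: the entries of the inverse are quotients of polynomials in the
entries. *)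
Lemma measurable_invmx n (A : T -> 'M[R]_n) :
  measurable_mx A -> measurable_mx (fun w => invmx (A w)).
Proof.
move=> mA i j.
rewrite (_ : (fun _ => _) = (fun w => if A w \in unitmx then
  (\det (A w))^-1 * cofactor (A w) j i else A w i j)); last first.
  by apply/funext => w; rewrite /invmx; case: ifP => // _; rewrite !mxE.
apply: measurable_fun_ifT; [exact: measurable_fun_unitmx| |exact: mA].
apply: measurable_funM; first by apply: measurable_funVr; exact: measurable_det.
apply: measurable_funM => //; apply: measurable_det => k l.
by under eq_fun do rewrite !mxE; exact: mA.
Qed.

Lemma measurable_big_maxe (I : Type) (s : seq I) (f : I -> T -> \bar R) :
  (forall i, measurable_fun setT (f i)) ->
  measurable_fun setT (fun w => \big[maxe/0%E]_(i <- s) f i w).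
Proof.
move=> mf; elim: s => [|i s IH].
  by under eq_fun do rewrite big_nil; exact: measurable_cst.
by under eq_fun do rewrite big_cons; exact: measurable_maxe.
Qed.

Lemma measurable_first_order n (A : T -> 'M[R]_n) (b : T -> 'cV[R]_n) k :
  measurable_mx A -> measurable_mx b ->
  measurable_fun setT (fun w => first_order (A w) (b w) k).
Proof.
move=> mA mb; have mB := measurable_invmx mA.
apply: measurable_funD.
  apply: measurable_sum => i; apply: measurableT_comp => //.
  by apply: measurable_funM; [exact: mB|exact: mb].
apply: measurable_sum => i; apply: measurable_sum => j; apply: measurableT_comp => //.
apply: measurable_funM; last exact: measurable_mulmx.
by apply: measurable_funM; [exact: mB|exact: mA].
Qed.

Lemma measurable_generic_sol n (A : T -> 'M[R]_n) (b : T -> 'cV[R]_n) :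
  measurable_mx A -> measurable_mx b ->
  measurable_mx (fun w => comparison_sol (A w) (b w)).
Proof.
move=> mA mb; apply: measurable_mulmx.
  apply: measurable_invmx => i j; under eq_fun do rewrite mxE.
  have mn : measurable_fun setT (fun w => `|A w i j|) by exact: measurableT_comp.
  by case: eqP => _ //; exact: measurable_funN.
by move=> i j; under eq_fun do rewrite mxE; exact: measurableT_comp.
Qed.

(** The closed form involves only arithmetic and case distinctions on measurable
functions. *)
Lemma measurable_cond_solve n (A : T -> 'M[R]_n) (b : T -> 'cV[R]_n) :
  (forall w, is_trig_mx (A w)) -> measurable_mx A -> measurable_mx b ->
  measurable_fun setT (fun w => cond_solve (A w) (b w)).
Proof.
move=> tA mA mb; pose x w := invmx (A w) *m b w.
have mx : measurable_mx x by apply: measurable_mulmx => //; exact: measurable_invmx.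
rewrite (_ : (fun _ => _) = (fun w => if A w \in unitmx then
    \big[maxe/0%E]_(k < n) (if x w k 0 == 0
      then if comparison_sol (A w) (b w) k 0 == 0 then 0%E else +oo%E
      else (first_order (A w) (b w) k / `|x w k 0|)%:E)
    else +oo%E)); last first.
  apply/funext => w; rewrite /cond_solve; case: ifP => // uA.
  by apply: eq_bigr => k _; rewrite cond_coordE.
apply: measurable_fun_ifT => //; first exact: measurable_fun_unitmx.
apply: measurable_big_maxe => k; apply: measurable_fun_ifT.
- by apply: measurable_fun_eqr => //; exact: mx.
- apply: measurable_fun_ifT => //.
  by apply: measurable_fun_eqr => //; exact: measurable_generic_sol.
- apply/measurable_EFinP; apply: measurable_funM; first exact: measurable_first_order.
  by apply: measurable_funVr; apply: measurableT_comp => //; exact: mx.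
Qed.

End Measurability.

(** * Ratios of affine functions of a Gaussian variable *)

(** The bound for one error term. Its constant is
((1 + sigma) / sigma) sqrt (2 / pi), by [normal_peakE_sqrt]. *)
Definition tail_bound (R : realType) (sigma s : R) : R :=
  2 * ((1 + sigma) * normal_peak sigma) / (s - 1).

Section GaussianRatio.
Variables (R : realType) (m sigma : R).
Hypotheses (sigma0 : 0 < sigma) (m1 : `|m| <= 1).

(** Since |x| <= 1 + |x - m|, it is enough that y <= sigma e^(y^2 / (2 sigma^2)), and
this follows from e^v >= 1 + v and (y - sigma)^2 >= 0. *)
Lemma norm_mul_normal_pdf_le x :
  `|x| * normal_pdf m sigma x <= (1 + sigma) * normal_peak sigma.
Proof.
rewrite normal_pdfE ?gt_eqF// mulrCA mulrC ler_wpM2r ?normal_peak_ge0//.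
rewrite /normal_fun mulNr expRN ler_pdivrMr ?expR_gt0//.
have vle := expR_ge1Dx ((x - m) ^+ 2 / (sigma ^+ 2 *+ 2)).
apply: le_trans (ler_wpM2l (addr_ge0 ler01 (ltW sigma0)) vle).
have xle : `|x| <= 1 + `|x - m|.
  rewrite -{1}(subrK m x) addrC; apply: le_trans (ler_normD _ _) _.
  by rewrite lerD2r.
apply: le_trans xle _.
rewrite -real_normK ?num_real//; set y := `|x - m|; have y0 : 0 <= y by exact: normr_ge0.
have v0 : 0 <= y ^+ 2 / (sigma ^+ 2 *+ 2) by rewrite divr_ge0 ?sqr_ge0// mulrn_wge0// sqr_ge0.
have : sigma * (y ^+ 2 / (sigma ^+ 2 *+ 2)) * (2 * sigma) = y ^+ 2.
  by field; rewrite gt_eqF.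
set v := _ / _ in v0 *; move=> vE.
have sq := sqr_ge0 (y - sigma).
have : y <= sigma * (1 + v) by rewrite -(ler_pM2r sigma0); nra.
nra.
Qed.

Lemma normal_prob_itv_le a b l : a <= b -> 0 < l ->
  (forall x, a <= x <= b -> l <= `|x|) ->
  (normal_prob m sigma `[a, b] <=
    ((b - a) / l * ((1 + sigma) * normal_peak sigma))%:E)%E.
Proof.
move=> ab l0 lx; set C := _ * normal_peak _.
have C0 : 0 <= C by rewrite mulr_ge0 ?normal_peak_ge0// addr_ge0// ltW.
apply: (@le_trans _ _ (\int[lebesgue_measure]_(x in `[a, b]) (C / l)%:E)%E).
  apply: ge0_le_integral => //=.
  - by move=> x _; rewrite lee_fin normal_pdf_ge0.
  - by apply/measurable_EFinP/measurable_funTS; exact: measurable_normal_pdf.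
  - move=> x; rewrite in_itv/= => xab; rewrite lee_fin ler_pdivlMr// mulrC.
    apply: le_trans (norm_mul_normal_pdf_le x).
    by rewrite ler_wpM2r ?normal_pdf_ge0// lx.
rewrite integral_cst//= lebesgue_measure_itv/= lte_fin.
case: ltP => ba; last by rewrite mule0 lee_fin mulr_ge0// divr_ge0 ?subr_ge0// ltW.
by rewrite -EFinB -EFinM lee_fin le_eqVlt; apply/orP; left; apply/eqP; field; rewrite gt_eqF.
Qed.

Lemma tail_bound_ge0 s : 1 < s -> 0 <= tail_bound sigma s.
Proof.
move=> s1; apply: divr_ge0; last by rewrite subr_ge0 ltW.
by do 2!apply: mulr_ge0 => //; [rewrite addr_ge0// ltW|exact: normal_peak_ge0].
Qed.

(** The set lies in an interval of length [|c| (r - l)], on which the density is at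
most a constant over [|c| l]. The scale [c] cancels: in the application it is
determined by the frozen entries, and the bound is uniform in them. *)
Lemma normal_prob_ratio_le (S : set R) c l r s : measurable S ->
  0 < l -> l <= r -> (r - l) / l = 2 / (s - 1) -> 1 < s ->
  (forall x, S x -> c != 0 /\ l <= x / c <= r) ->
  (normal_prob m sigma S <= (tail_bound sigma s)%:E)%E.
Proof.
move=> mS l0 lr lrs s1 hS.
have -> : tail_bound sigma s = (r - l) / l * ((1 + sigma) * normal_peak sigma).
  by rewrite lrs /tail_bound mulrAC.
have [cp|cn|c0] := ltgtP 0 c.
- apply: (@le_trans _ _ (normal_prob m sigma `[c * l, c * r])).
    apply: le_measure; rewrite ?inE// => x /hS[_] /=; rewrite in_itv/=.
    by rewrite ler_pdivlMr// ler_pdivrMr// ![_ * c]mulrC.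
  apply: le_trans (normal_prob_itv_le _ (mulr_gt0 cp l0) _) _.
  + by rewrite ler_pM2l.
  + by move=> x /andP[lx _]; apply: le_trans lx (ler_norm _).
  + by rewrite -mulrBr -mulf_div divff ?gt_eqF// mul1r.
- apply: (@le_trans _ _ (normal_prob m sigma `[c * r, c * l])).
    apply: le_measure; rewrite ?inE// => x /hS[_] /=; rewrite in_itv/=.
    by rewrite ler_ndivlMr// ler_ndivrMr// ![_ * c]mulrC andbC.
  apply: le_trans (normal_prob_itv_le _ (_ : 0 < - c * l) _) _.
  + by rewrite ler_nM2l.
  + by rewrite mulr_gt0// oppr_gt0.
  + move=> x /andP[_ xl]; rewrite -normrN; apply: le_trans (ler_norm _).
    by rewrite mulNr lerN2.
  + by rewrite -mulrBr -opprB mulrN -mulNr -mulf_div divff ?oppr_eq0 ?lt_eqF// mul1r.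
- have -> : S = set0.
    by apply/seteqP; split=> // x /hS[]; rewrite -c0 eqxx.
  rewrite measure0 lee_fin; apply: mulr_ge0; first by rewrite lrs divr_ge0 ?subr_ge0 ?ltW.
  by apply: mulr_ge0; [rewrite addr_ge0// ltW|exact: normal_peak_ge0].
Qed.

(** With [z = x / c] and [c = - q / p] the event reads [s |z - 1| < |z|], that is
[s / (s + 1) < z < s / (s - 1)]. *)
Lemma normal_prob_affine_le (p q s : R) : 1 < s ->
  (normal_prob m sigma [set x | (s * `|p * x + q| < `|p * x|)%R]
    <= (tail_bound sigma s)%:E)%E.
Proof.
move=> s1; have s10 : 0 < s - 1 by rewrite subr_gt0.
have s0 : 0 < s by apply: lt_trans s1.
apply: (@normal_prob_ratio_le _ (- q / p) (s / (s + 1)) (s / (s - 1))) => //.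
- apply: measurable_lt_set.
    apply: measurable_funM => //; apply: measurableT_comp => //.
    by apply: measurable_funD => //; exact: measurable_funM.
  by apply: measurableT_comp => //; exact: measurable_funM.
- by rewrite divr_gt0// addr_gt0.
- by rewrite ler_pM2l// lef_pV2 ?posrE//; lra.
- by field; rewrite !gt_eqF// addr_gt0.
move=> x /= Sx.
have p0 : p != 0.
  apply: contraTneq Sx => ->; rewrite mul0r normr0 add0r -leNgt.
  by rewrite mulr_ge0// ltW.
have q0 : q != 0.
  by apply: contraTneq Sx => ->; rewrite addr0 -leNgt ler_peMl// ltW.
split; first by rewrite mulf_neq0 ?oppr_eq0 ?invr_eq0.
have : s * `|x / (- q / p) - 1| < `|x / (- q / p)|.
  rewrite -(ltr_pM2r (_ : 0 < `|q|)) ?normr_gt0// -mulrA -!normrM.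
  rewrite (_ : (x / (- q / p) - 1) * q = - (p * x + q)); last by field; rewrite p0 q0.
  by rewrite (_ : x / (- q / p) * q = - (p * x)) ?normrN//; field; rewrite p0 q0.
set z := x / _; move=> hz; have z0 : 0 < z.
  rewrite ltNge; apply/negP => z0; move: hz.
  rewrite (ler0_norm z0) ler0_norm; last lra.
  nra.
rewrite (gtr0_norm z0) in hz.
have h1 := ler_norm (z - 1); have h2 := ler_norm (- (z - 1)); rewrite normrN in h2.
apply/andP; split; [rewrite ler_pdivrMr ?addr_gt0//|rewrite ler_pdivlMr//]; nra.
Qed.

(** With [z = x / c] and [c = - p / q] the event reads [s |z - 1| < 1], that is
[(s - 1) / s < z < (s + 1) / s]. *)
Lemma normal_prob_affineV_le (p q s : R) : 1 < s ->
  (normal_prob m sigma [set x | (s * `|p + q * x| < `|p|)%R]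
    <= (tail_bound sigma s)%:E)%E.
Proof.
move=> s1; have s10 : 0 < s - 1 by rewrite subr_gt0.
have s0 : 0 < s by apply: lt_trans s1.
apply: (@normal_prob_ratio_le _ (- p / q) ((s - 1) / s) ((s + 1) / s)) => //.
- apply: measurable_lt_set => //.
  apply: measurable_funM => //; apply: measurableT_comp => //.
  by apply: measurable_funD => //; exact: measurable_funM.
- by rewrite divr_gt0.
- by rewrite ler_pM2r ?invr_gt0//; lra.
- by field; rewrite !gt_eqF.
move=> x /= Sx.
have p0 : p != 0.
  by apply: contraTneq Sx => ->; rewrite normr0 -leNgt mulr_ge0// ltW.
have q0 : q != 0.
  by apply: contraTneq Sx => ->; rewrite mul0r addr0 -leNgt ler_peMl// ltW.
split; first by rewrite mulf_neq0 ?oppr_eq0 ?invr_eq0.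
have : s * `|x / (- p / q) - 1| < 1.
  rewrite -(ltr_pM2r (_ : 0 < `|p|)) ?normr_gt0// -mulrA -!normrM mul1r.
  rewrite (_ : (x / (- p / q) - 1) * p = - (p + q * x)) ?normrN//.
  by field; rewrite p0 q0.
set z := x / _; move=> hz.
have h1 := ler_norm (z - 1); have h2 := ler_norm (- (z - 1)); rewrite normrN in h2.
apply/andP; split; [rewrite ler_pdivrMr//|rewrite ler_pdivlMr//]; nra.
Qed.

End GaussianRatio.

(** * Freezing all but one of a family of independent variables *)

Section Independence.
Context d (T : measurableType d) (R : realType) (P : probability T R).
Variables (I : finType) (X : I -> T -> R).
Hypothesis mX : forall i, measurable_fun setT (X i).
Hypothesis indX : mutually_independent P X.
Variable e : I.

Definition others : {set I} := finset (fun i => i != e).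

(** A pi-system that generates the sigma-algebra of the variables other than [X e]. *)
Definition other_events : set (set T) :=
  [set A | exists B : I -> set R, (forall i, measurable (B i)) /\
     A = \bigcap_(i in [set` others]) (X i @^-1` B i)].

Local Notation T' := (g_sigma_algebraType other_events).

Lemma measurable_preimage i B : measurable B -> measurable (X i @^-1` B).
Proof. by move=> mB; rewrite -[X in measurable X]setTI; exact: mX. Qed.

Lemma other_events_measurable : other_events `<=` measurable.
Proof.
move=> _ [B [mB ->]]; apply: fin_bigcap_measurable => [|i _].
  exact: finite_finset.
exact: measurable_preimage.
Qed.

Lemma g_other_events_measurable : <<s other_events >> `<=` measurable.
Proof.
exact: smallest_sub (@sigma_algebra_measurable _ T) other_events_measurable.
Qed.

Lemma measurable_other i : i != e -> measurable_fun setT (X i : T' -> R).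
Proof.
move=> ie _ B mB; rewrite setTI; apply: sub_sigma_algebra.
exists (fun j => if j == i then B else setT); split => [j|]; first by case: eqP.
apply/seteqP; split => [w Xw j _|w /(_ i)]; first by rewrite /=; case: eqP => // ->.
by rewrite /= eqxx; apply; rewrite inE.
Qed.

(** Both sides are finite measures in [A]; they agree on the generating pi-system by
the product rule. *)
Lemma other_events_independent A B : <<s other_events >> A -> measurable B ->
  P (A `&` X e @^-1` B) = (P A * P (X e @^-1` B))%E.
Proof.
move=> sA mB; have mXB := measurable_preimage e mB.
have PB : P (X e @^-1` B) \is a fin_num by exact: fin_num_measure.
have PB0 : 0 <= fine (P (X e @^-1` B)) by rewrite fine_ge0.
have -> : (P A * P (X e @^-1` B) = mscale (NngNum PB0) P A)%E.
  by rewrite /mscale/= fineK// muleC.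
rewrite -/(mrestr P mXB A).
apply: (g_sigma_algebra_measure_unique other_events other_events_measurable (fun=> setT)) sA.
- move=> _; exists (fun=> setT); split => //.
  by apply/seteqP; split.
- by apply/seteqP; split => // w _; exists 0%N.
- move=> _ _ [B1 [mB1 ->]] [B2 [mB2 ->]].
  exists (fun i => B1 i `&` B2 i); split => [i|]; first exact: measurableI.
  by rewrite -bigcapI.
- move=> _ [B1 [mB1 ->]]; set A' := \bigcap_(i in _) _.
  change (P (A' `&` X e @^-1` B) = (fine (P (X e @^-1` B)))%:E * P A')%E.
  rewrite fineK// /A'.
  pose B' i := if i == e then B else B1 i.
  have mB' i : measurable (B' i) by rewrite /B'; case: eqP.
  have -> : \bigcap_(i in [set` others]) (X i @^-1` B1 i) `&` X e @^-1` B =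
      \bigcap_(i in [set` finset.setT]) (X i @^-1` B' i).
    apply/seteqP; split => [w [h he] i _|w h].
      rewrite /B'; case: eqP => [->//|/eqP ie].
      by apply: h; rewrite /= inE.
    split => [i|]; last by have := h e; rewrite /B' eqxx; apply; rewrite /= inE.
    by rewrite /= inE => ie; have := h i; rewrite /B' (negPf ie); apply; rewrite /= inE.
  rewrite indX// indX// (bigD1 e) ?inE//= {1}/B' eqxx; congr (_ * _)%E.
  apply: eq_big => [i|i /andP[_ ie]]; first by rewrite !inE.
  by rewrite /B' (negPf ie).
- move=> _; change (P (setT `&` X e @^-1` B) < +oo)%E.
  by rewrite setTI ltey_eq fin_num_measure.
Qed.

(** By the previous lemma the joint law of the frozen sigma-algebra and of [X e] is a
product measure, so that the probability of [S] is the integral over the frozen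
outcomes of the probabilities of its sections. Using the sample space itself,
with the coarser sigma-algebra, as first factor avoids products of many real
lines. *)
Lemma independent_section_le (S : set (T' * R)) (A : set T) (c : \bar R) :
  measurable S -> (forall w, (P (X e @^-1` xsection S w) <= c)%E) ->
  measurable A -> (forall w, A w -> S (w, X e w)) -> (P A <= c)%E.
Proof.
move=> mS hc mA AS.
pose nu : probability R R := distribution P (mfun_Sub (mem_set (mX e))).
have mid : measurable_fun setT (id : T -> T').
  by move=> _ B mB; rewrite setTI; exact: g_other_events_measurable.
have mpair : measurable_fun setT (fun w => (w, X e w) : T' * R).
  exact: measurable_fun_pair.
pose PT : probability T' R := distribution P (mfun_Sub (mem_set mid)).
pose PTR : probability (T' * R)%type R := distribution P (mfun_Sub (mem_set mpair)).
apply: (@le_trans _ _ (PTR S)).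
  apply: le_measure; rewrite ?inE//.
  by rewrite -[X in measurable X]setTI; exact: (mpair measurableT S mS).
rewrite -(@product_measure_unique _ _ _ _ _ PT nu PTR)//; last first.
  move=> A1 B mA1 mB.
  exact: other_events_independent.
have c0 : (0 <= c)%E by apply: le_trans (hc point).
apply: (@le_trans _ _ (\int[PT]_w c)%E); last first.
  have [cfin|] := boolP (c \is a fin_num).
    rewrite -(fineK cfin) integral_cst//.
    by rewrite [X in (_ * X <= _)%E](_ : _ = 1%E) ?mule1//; exact: (probability_setT PT).
  by rewrite ge0_fin_numE// -leNgt leye_eq => /eqP ->; rewrite leey.
apply: ge0_le_integral => //; first exact: measurable_fun_xsection.
by move=> w _; exact: hc.
Qed.

End Independence.

(** * Tails of the individual error terms *)

Section FrozenEntry.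
Variables (R : realType) (n : nat).
Implicit Types (A : 'M[R]_n) (b : 'cV[R]_n).

(** Replacing an entry by a constant makes every function of the matrix measurable
with respect to the other entries; written as an update so that
[sol_update_mat] applies. *)
Definition set_mx A i j v := A + (v - A i j) *: delta_mx i j.
Definition set_cv b i v := b + (v - b i 0) *: delta_mx i 0 : 'cV[R]_n.

Lemma set_mxE A i j v k l :
  set_mx A i j v k l = if (k == i) && (l == j) then v else A k l.
Proof.
rewrite !mxE; case: ifP => [/andP[/eqP-> /eqP->]|_]; last by rewrite mulr0 addr0.
by rewrite mulr1 addrC subrK.
Qed.

Lemma set_cvE b i v k : set_cv b i v k 0 = if k == i then v else b k 0.
Proof.
rewrite !mxE andbT; case: eqP => [->|_]; last by rewrite mulr0 addr0.
by rewrite mulr1 addrC subrK.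
Qed.

Lemma set_mx_trig A (i j : 'I_n) v : is_trig_mx A -> (j <= i)%N -> is_trig_mx (set_mx A i j v).
Proof.
move=> /is_trig_mxP tA ji; apply/is_trig_mxP => k l kl.
rewrite set_mxE; case: ifP => [/andP[/eqP ki /eqP lj]|_]; last exact: tA.
by move: kl; rewrite ki lj ltnNge ji.
Qed.

Lemma set_mx_unit A (i j : 'I_n) v : is_trig_mx A -> A \in unitmx -> (j < i)%N ->
  set_mx A i j v \in unitmx.
Proof.
move=> tA uA ji; rewrite trig_unitmxE ?set_mx_trig// 1?ltnW//.
apply/forallP => k; rewrite set_mxE; case: ifP => [/andP[/eqP ki /eqP kj]|_].
  by move: ji; rewrite -ki -kj ltnn.
exact: trig_diag_neq0.
Qed.

Lemma set_mx_diag_unit A (i : 'I_n) v : is_trig_mx A -> A \in unitmx -> v != 0 ->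
  set_mx A i i v \in unitmx.
Proof.
move=> tA uA v0; rewrite trig_unitmxE ?set_mx_trig//.
apply/forallP => k; rewrite set_mxE; case: ifP => // _.
exact: trig_diag_neq0.
Qed.

(* strictly lower entry *)
Lemma sol_set_mx A b (i j k : 'I_n) v : is_trig_mx A -> A \in unitmx -> (j < i)%N ->
  (invmx (set_mx A i j v) *m b) k 0 =
  (invmx A *m b) k 0 - invmx A k i * (v - A i j) * (invmx A *m b) j 0.
Proof.
move=> tA uA ji; have uA' := set_mx_unit v tA uA ji.
by rewrite sol_update_mat// sol_update_mat// (invmx_trig tA uA ji) !mul0r subr0.
Qed.

(** The unknown [k] is affine in a strictly lower entry, because neither
[invmx A k i] nor the unknown [j] depends on it. The coefficients [p] and [q] are
read off at the values 0 and 1 of the entry, hence do not depend on it either. *)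
Lemma err_mat_lower A b (i j k : 'I_n) : is_trig_mx A -> A \in unitmx -> (j < i)%N ->
  let q := (invmx (set_mx A i j 0) *m b) k 0 in
  let p := (invmx (set_mx A i j 1) *m b) k 0 - q in
  (invmx A *m b) k 0 = p * A i j + q /\ err_mat A b k i j = - (p * A i j).
Proof.
move=> tA uA ji /=; rewrite /err_mat !sol_set_mx//.
set x := (_ *m _) k 0; set y := (_ *m _) j 0.
by split; ring.
Qed.

Lemma err_rhs_affine A b (i k : 'I_n) : A \in unitmx ->
  let q := (invmx A *m set_cv b i 0) k 0 in
  let p := (invmx A *m set_cv b i 1) k 0 - q in
  (invmx A *m b) k 0 = p * b i 0 + q /\ err_rhs A b k i = p * b i 0.
Proof.
move=> uA /=; rewrite /err_rhs !sol_update_rhs//.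
by set x := (_ *m _) k 0; split; ring.
Qed.

(** The [i]-th unknown is inversely proportional to the diagonal entry. *)
Lemma sol_set_mx_diag A b (i k : 'I_n) v : is_trig_mx A -> A \in unitmx -> v != 0 ->
  (invmx (set_mx A i i v) *m b) k 0 =
  (invmx A *m b) k 0 - invmx A k i * (v - A i i) * ((invmx A *m b) i 0 * A i i / v).
Proof.
move=> tA uA v0; have uA' := set_mx_diag_unit i tA uA v0.
rewrite sol_update_mat//; congr (_ - _ * _).
have := sol_update_mat b i uA uA'.
rewrite -/(set_mx A i i v); set x' := (_ *m _) i 0 => h.
have B1 := invmx_trig_diag i tA uA; have a0 := trig_diag_neq0 i tA uA.
have Bv : invmx A i i = (A i i)^-1 by apply: (mulfI a0); rewrite B1 divff.
move: h; rewrite Bv; set x := (_ *m _) i 0 => h.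
have : x' * v = x * A i i.
  have -> : x' * v = A i i * (x' + (A i i)^-1 * (v - A i i) * x').
    by field.
  by rewrite {1}h; field.
by move=> <-; rewrite mulfK.
Qed.

(** The unknown [k] is affine in the inverse of a diagonal entry; the value 0 is not
allowed here, so the coefficients are read off at the values 1 and -1. *)
Lemma err_mat_diag A b (i k : 'I_n) : is_trig_mx A -> A \in unitmx ->
  let xp := (invmx (set_mx A i i 1) *m b) k 0 in
  let xm := (invmx (set_mx A i i (-1)) *m b) k 0 in
  let p := (xp - xm) / 2 in let q := (xp + xm) / 2 in
  A i i * (invmx A *m b) k 0 = p + q * A i i /\ A i i * err_mat A b k i i = p.
Proof.
move=> tA uA /=; rewrite /err_mat !sol_set_mx_diag ?oppr_eq0 ?oner_eq0//.
set x := (_ *m _) k 0; set y := (_ *m _) i 0.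
by split; field.
Qed.

End FrozenEntry.

Section TermTails.
Context d (T : measurableType d) (R : realType) (P : probability T R).
Variables (n : nat) (sigma : R) (Lbar : 'M[R]_n) (bbar : 'cV[R]_n)
  (L : T -> 'M[R]_n) (b : T -> 'cV[R]_n).
Hypotheses (hsigma : 0 < sigma)
  (hLbar1 : mx_norm Lbar <= 1) (hbbar1 : mx_norm bbar <= 1)
  (hLb : gaussian_triangular P L b Lbar bbar sigma).

Let X (e : entry n) w := entry_value (L w) (b w) e.

Lemma le_mx_norm m p (A : 'M[R]_(m, p)) i j : `|A i j| <= mx_norm A.
Proof. by rewrite mx_normrE; exact: (le_bigmax _ (fun ij => `|A ij.1 ij.2|) (i, j)). Qed.

Lemma entry_mean_le1 e : `|entry_value Lbar bbar e| <= 1.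
Proof.
by case: e => [ij|i] /=; [apply: le_trans hLbar1|apply: le_trans hbbar1]; exact: le_mx_norm.
Qed.

Lemma measurable_entry e : measurable_fun setT (X e).
Proof. by have [_ /(_ e)[]] := hLb. Qed.

Lemma measurable_L : measurable_mx L.
Proof.
have [tL _ _] := hLb; move=> i j; have [ji|ij] := leqP j i.
  exact: (measurable_entry (inl (Sub (i, j) ji))).
rewrite (_ : (fun _ => _) = cst 0); first exact: measurable_cst.
by apply/funext => w; have /is_trig_mxP/(_ i j ij) := tL w.
Qed.

Lemma measurable_b : measurable_mx b.
Proof. by move=> i j; rewrite (ord1 j); exact: (measurable_entry (inr i)). Qed.

Local Notation frozen e := (g_sigma_algebraType (other_events X e)).

(** [independent_section_le] for the given entries, whose laws are Gaussian. *)
Lemma frozen_le e (S : set (frozen e * R)) (A : set T) (c : \bar R) :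
  measurable S ->
  (forall w, (normal_prob (entry_value Lbar bbar e) sigma
                [set x | S (w, x)] <= c)%E) ->
  measurable A -> (forall w, A w -> S (w, X e w)) -> (P A <= c)%E.
Proof.
move=> mS hc mA AS; have [_ hX indX] := hLb.
apply: (independent_section_le measurable_entry indX (e := e) mS _ mA AS) => w.
have [_ law] := hX e; rewrite -[X in (X <= _)%E]/(pushforward P (X e) (xsection S w)).
rewrite law; last exact: measurable_xsection.
rewrite (_ : xsection S w = [set x | S (w, x)]); first exact: hc.
by apply/seteqP; split => x; rewrite /xsection /= inE.
Qed.

Lemma frozen_affine_le e (p q : frozen e -> R) s (A : set T) : 1 < s ->
  measurable_fun setT p -> measurable_fun setT q -> measurable A ->
  (forall w, A w -> s * `|p w * X e w + q w| < `|p w * X e w|) ->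
  (P A <= (tail_bound sigma s)%:E)%E.
Proof.
move=> s1 mp mq mA hA.
pose S : set (frozen e * R) :=
  [set z | s * `|p z.1 * z.2 + q z.1| < `|p z.1 * z.2|].
apply: (@frozen_le e S _ _ _ _ mA hA) => [|w].
  have mpz : measurable_fun setT (fun z : frozen e * R => p z.1 * z.2).
    by apply: measurable_funM => //; exact: measurableT_comp.
  apply: measurable_lt_set; last exact: measurableT_comp.
  apply: measurable_funM => //; apply: measurableT_comp => //.
  by apply: measurable_funD => //; exact: measurableT_comp.
rewrite (_ : [set x | S (w, x)] = [set x | s * `|p w * x + q w| < `|p w * x|])//.
exact: normal_prob_affine_le hsigma (entry_mean_le1 e) _ _ _ s1.
Qed.

Lemma frozen_affineV_le e (p q : frozen e -> R) s (A : set T) : 1 < s ->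
  measurable_fun setT p -> measurable_fun setT q -> measurable A ->
  (forall w, A w -> s * `|p w + q w * X e w| < `|p w|) ->
  (P A <= (tail_bound sigma s)%:E)%E.
Proof.
move=> s1 mp mq mA hA.
pose S : set (frozen e * R) := [set z | s * `|p z.1 + q z.1 * z.2| < `|p z.1|].
apply: (@frozen_le e S _ _ _ _ mA hA) => [|w].
  have mpz : measurable_fun setT (fun z : frozen e * R => p z.1).
    exact: measurableT_comp.
  apply: measurable_lt_set; last exact: measurableT_comp.
  apply: measurable_funM => //; apply: measurableT_comp => //.
  apply: measurable_funD => //; apply: measurable_funM => //.
  exact: measurableT_comp.
rewrite (_ : [set x | S (w, x)] = [set x | s * `|p w + q w * x| < `|p w|])//.
exact: normal_prob_affineV_le hsigma (entry_mean_le1 e) _ _ _ s1.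
Qed.

Lemma measurable_frozen_set_mx (i j : 'I_n) (ji : (j <= i)%N) v :
  measurable_mx (fun w : frozen (inl (Sub (i, j) ji)) => set_mx (L w) i j v).
Proof.
have [tL _ _] := hLb.
move=> k l; apply: (eq_measurable_fun
  (fun w : frozen (inl (Sub (i, j) ji)) =>
    if (k == i) && (l == j) then v else L w k l)).
  by move=> w _; rewrite set_mxE.
have [_|/negbTE kl] := boolP ((k == i) && (l == j)); first exact: measurable_cst.
have [lk|lk] := leqP l k.
  apply: (@measurable_other _ _ _ _ X _ (inl (Sub (k, l) lk))).
  by apply: contraFneq kl => -[-> ->]; rewrite !eqxx.
apply: (eq_measurable_fun (fun _ : frozen (inl (Sub (i, j) ji)) => 0 : R));
  last exact: measurable_cst.
by move=> w _; have /is_trig_mxP/(_ k l lk) := tL w.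
Qed.

Lemma measurable_frozen_b ij :
  measurable_mx (b : frozen (inl ij) -> 'cV[R]_n).
Proof.
by move=> i j; rewrite (ord1 j); exact: (@measurable_other _ _ _ _ X _ (inr i)).
Qed.

Lemma measurable_frozen_L i :
  measurable_mx (L : frozen (inr i) -> 'M[R]_n).
Proof.
have [tL _ _] := hLb.
move=> k l; have [lk|lk] := leqP l k.
  exact: (@measurable_other _ _ _ _ X _ (inl (Sub (k, l) lk))).
apply: (eq_measurable_fun (fun _ : frozen (inr i) => 0 : R)); last exact: measurable_cst.
by move=> w _; have /is_trig_mxP/(_ k l lk) := tL w.
Qed.

Lemma measurable_frozen_set_cv i v :
  measurable_mx (fun w : frozen (inr i) => set_cv (b w) i v).
Proof.
move=> k l; rewrite (ord1 l); apply: (eq_measurable_fun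
  (fun w : frozen (inr i) => if k == i then v else b w k 0)); first by move=> w _; rewrite set_cvE.
have [_|/negbTE ki] := boolP (k == i); first exact: measurable_cst.
apply: (@measurable_other _ _ _ _ X _ (inr k)).
by apply: contraFneq ki => -[->].
Qed.

(** Nonsingularity is part of the event, because the formulas for an error term as a
function of a single entry hold only then. *)
Definition large_term (s : R) (k : 'I_n) (err : T -> R) : set T :=
  [set w | (L w \in unitmx) &&
    (s * `|(invmx (L w) *m b w) k 0| < `|err w|)].

Lemma measurable_large_term s k err : measurable_fun setT err ->
  measurable (large_term s k err).
Proof.
move=> me; rewrite -[X in measurable X]setTI.
suff mt : measurable_fun setT (fun w => (L w \in unitmx) &&
    (s * `|(invmx (L w) *m b w) k 0| < `|err w|)).
  exact: (mt measurableT [set true]).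
apply: measurable_and => //; first exact: measurable_fun_unitmx measurable_L.
apply: measurable_fun_ltr; last exact: measurableT_comp.
apply: measurable_funM => //; apply: measurableT_comp => //.
apply: measurable_mulmx measurable_b _ _; exact: measurable_invmx measurable_L.
Qed.

Lemma err_rhs_tail s k i : 1 < s ->
  measurable (large_term s k (fun w => err_rhs (L w) (b w) k i)) /\
  (P (large_term s k (fun w => err_rhs (L w) (b w) k i)) <= (tail_bound sigma s)%:E)%E.
Proof.
move=> s1; have me : measurable_fun setT (fun w => err_rhs (L w) (b w) k i).
  by apply: measurable_funM; [exact: measurable_invmx measurable_L _ _|exact: measurable_b].
have mlt := measurable_large_term s k me; split => //.
have mB := measurable_invmx (@measurable_frozen_L i).
have msol v := measurable_mulmx mB (@measurable_frozen_set_cv i v) k 0.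
apply: (frozen_affine_le (e := inr i) s1 (measurable_funB (msol 1) (msol 0)) (msol 0) mlt).
move=> w /andP[uL]; have [-> ->] := err_rhs_affine (b w) i k uL.
by [].
Qed.

(** The three cases are: below the diagonal, where the unknown is affine in the
entry; above it, where the term is 0; and on it. *)
Lemma err_mat_tail s k i j : 1 < s ->
  measurable (large_term s k (fun w => err_mat (L w) (b w) k i j)) /\
  (P (large_term s k (fun w => err_mat (L w) (b w) k i j)) <= (tail_bound sigma s)%:E)%E.
Proof.
move=> s1; have s0 : 0 < s by apply: lt_trans s1.
have [tL _ _] := hLb.
have me : measurable_fun setT (fun w => err_mat (L w) (b w) k i j).
  apply: measurable_funM.
    by apply: measurable_funM; [exact: measurable_invmx measurable_L _ _|exact: measurable_L].
  apply: measurable_mulmx measurable_b _ _; exact: measurable_invmx measurable_L.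
have mlt := measurable_large_term s k me; split => //.
have [ji|ij|ji] := ltngtP j i.
- have mb := @measurable_frozen_b (Sub (i, j) (ltnW ji)).
  have msol v := measurable_mulmx
    (measurable_invmx (@measurable_frozen_set_mx i j (ltnW ji) v)) mb k 0.
  apply: (frozen_affine_le (e := inl (Sub (i, j) (ltnW ji))) s1
    (measurable_funB (msol 1) (msol 0)) (msol 0) mlt).
  move=> w /andP[uL]; have [-> ->] := err_mat_lower (b w) k (tL w) uL ji.
  by rewrite normrN.
- rewrite (_ : large_term _ _ _ = set0) ?measure0 ?lee_fin.
    exact: tail_bound_ge0.
  apply/seteqP; split => // w /andP[_]; rewrite /err_mat.
  have /is_trig_mxP/(_ i j ij) -> := tL w.
  rewrite mulr0 mul0r normr0; apply/negP; rewrite -leNgt; apply: mulr_ge0 => //; exact: ltW.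
- have {}ji : j = i by exact: val_inj.
  subst j; have ii : (i <= i)%N by exact: leqnn.
  have mb := @measurable_frozen_b (Sub (i, i) ii).
  have msol v := measurable_mulmx (measurable_invmx (@measurable_frozen_set_mx i i ii v)) mb k 0.
  have m2 (f : frozen (inl (Sub (i, i) ii)) -> R) :
      measurable_fun setT f -> measurable_fun setT (fun w => f w / 2).
    by move=> mf; exact: measurable_funM.
  apply: (frozen_affineV_le (e := inl (Sub (i, i) ii)) s1
    (m2 _ (measurable_funB (msol 1) (msol (-1))))
    (m2 _ (measurable_funD (msol 1) (msol (-1)))) mlt).
  move=> w /andP[uL]; have [ax ae] := err_mat_diag (b w) i k (tL w) uL.
  have a0 : 0 < `|L w i i| by rewrite normr_gt0 trig_diag_neq0.
  move=> h; have : `|L w i i| * (s * `|(invmx (L w) *m b w) k 0|) <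
      `|L w i i| * `|err_mat (L w) (b w) k i i| by rewrite ltr_pM2l.
  by rewrite -normrM ae mulrCA -normrM ax.
Qed.

End TermTails.

(** * Tail of the condition number *)

(** Among the terms of [first_order], the one of [A k k] equals the unknown [k] up to
sign. If all the other ones were at most [s] times the unknown, their sum would
be at most [t - 1] times it. When the unknown is 0, the term of [b k 0] exceeds
it. *)
Lemma cond_coord_gt_term (R : realType) n (A : 'M[R]_n) (b : 'cV[R]_n)
    (k : 'I_n) (t s : R) :
  is_trig_mx A -> A \in unitmx -> b k 0 != 0 -> 
  (n%:R * (n%:R + 1) - 1) * s = t - 1 -> 0 <= t ->
  (t%:E < cond_coord k A b)%E ->
  (exists i, s * `|(invmx A *m b) k 0| < `|err_rhs A b k i|) \/
  (exists2 ij, ij != (k, k) &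
     s * `|(invmx A *m b) k 0| < `|err_mat A b k ij.1 ij.2|).
Proof.
move=> tA uA bk st t0; rewrite cond_coordE//; set x := (_ *m _) k 0.
case: eqVneq => [-> _|x0].
  left; exists k; rewrite normr0 mulr0 normr_gt0 /err_rhs.
  by rewrite mulf_neq0// invmx_trig_diag_neq0.
have xp : 0 < `|x| by rewrite normr_gt0.
rewrite lte_fin ltr_pdivlMr// => tS.
apply: contrapT => /not_orP[hr hm].
move: tS; apply/negP; rewrite -leNgt.
have kk : `|err_mat A b k k k| = `|x|.
  by rewrite /err_mat (mulrC (invmx A k k)) invmx_trig_diag// mul1r.
rewrite /first_order pair_big/= (bigD1 (k, k))//= kk.
have n1 : (0 < n)%N by case: n k {A b tA uA bk st x x0 xp hr hm kk} => // -[].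
have sr : \sum_i `|err_rhs A b k i| <= n%:R * (s * `|x|).
  apply: (@le_trans _ _ (\sum_(i < n) s * `|x|)).
    by apply: ler_sum => i _; rewrite leNgt; apply/negP => h; apply: hr; exists i.
  by rewrite sumr_const card_ord mulr_natl.
have sm : \sum_(ij | ij != (k, k)) `|err_mat A b k ij.1 ij.2| <= (n%:R * n%:R - 1) * (s * `|x|).
  apply: (@le_trans _ _ (\sum_(ij : 'I_n * 'I_n | ij != (k, k)) s * `|x|)).
    by apply: ler_sum => ij ijk; rewrite leNgt; apply/negP => h; apply: hm; exists ij.
  rewrite sumr_const cardC1 card_prod card_ord -subn1.
  by rewrite -[X in X <= _]mulr_natl natrB ?muln_gt0 ?n1// natrM.
have -> : t * `|x| = (n%:R * (n%:R + 1) - 1) * s * `|x| + `|x| by rewrite st; ring.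
rewrite addrCA addrC lerD2r; apply: le_trans (lerD sr sm) _.
by rewrite le_eqVlt; apply/orP; left; apply/eqP; ring.
Qed.

Section Tail.
Context d (T : measurableType d) (R : realType) (P : probability T R).

Lemma measure_bigsetU_le (I : Type) (s : seq I) (Q : pred I) (F : I -> set T) :
  (forall i, Q i -> measurable (F i)) ->
  (P (\big[setU/set0]_(i <- s | Q i) F i) <= \sum_(i <- s | Q i) P (F i))%E.
Proof.
move=> mF; elim: s => [|i s IH]; first by rewrite !big_nil measure0.
rewrite !big_cons; case: ifP => // Qi.
have mU : measurable (\big[setU/set0]_(i <- s | Q i) F i) by exact: bigsetU_measurable.
by apply: le_trans (measureU2 _ _ _) _ => //; [exact: mF|exact: leeD].
Qed.

Variables (n : nat) (sigma : R) (Lbar : 'M[R]_n) (bbar : 'cV[R]_n)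
  (L : T -> 'M[R]_n) (b : T -> 'cV[R]_n).
Hypotheses (hn : (0 < n)%N) (hsigma : 0 < sigma)
  (hLbar1 : mx_norm Lbar <= 1) (hbbar1 : mx_norm bbar <= 1)
  (hLb : gaussian_triangular P L b Lbar bbar sigma).

Lemma entry_eq0_null (e : entry n) :
  measurable [set w | entry_value (L w) (b w) e = 0] /\
  P [set w | entry_value (L w) (b w) e = 0] = 0%E.
Proof.
have [_ /(_ e)[me law] _] := hLb; split.
  rewrite -[X in measurable X]setTI.
  by apply: (me _ [set 0]) => //; exact: measurable_set1.
have := law [set 0] (measurable_set1 0); rewrite /pushforward => ->.
by rewrite /normal_prob integral_set1.
Qed.

Let N : R := n%:R * (n%:R + 1).

(** Outside the null events that a diagonal entry or an entry of the right-hand side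
is 0, the event is covered by [n (N - 1)] events of [large_term]. *)
Lemma cond_solve_tail t : N < t ->
  (P [set w | t%:E < cond_solve (L w) (b w)] <=
    (n%:R * (N - 1) ^+ 2 * (2 * ((1 + sigma) * normal_peak sigma)) / (t - N))%:E)%E.
Proof.
move=> Nt; have [tL _ _] := hLb.
have n1 : 1 <= n%:R :> R by rewrite ler1n.
have N2 : 2 <= N by rewrite /N; nra.
have N10 : 0 < N - 1 by lra.
pose s := (t - 1) / (N - 1).
have s1 : 1 < s by rewrite ltr_pdivlMr//; lra.
have sE : (N - 1) * s = t - 1 by rewrite mulrC divfK ?gt_eqF.
have tb : tail_bound sigma s = (N - 1) * (2 * ((1 + sigma) * normal_peak sigma)) / (t - N).
  have s1E : s - 1 = (t - N) / (N - 1) by rewrite /s; field; rewrite gt_eqF.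
  have tN : t - N != 0 by rewrite gt_eqF ?subr_gt0.
  by rewrite /tail_bound s1E; field; rewrite tN gt_eqF.
pose Z e := [set w | entry_value (L w) (b w) e = 0].
pose LTr k i := large_term L b s k (fun w => err_rhs (L w) (b w) k i).
pose LTm k (ij : 'I_n * 'I_n) := large_term L b s k (fun w => err_mat (L w) (b w) k ij.1 ij.2).
(* The events that cover the case of the k-th unknown: the null events first. *)
pose bad (k : 'I_n) := (Z (inl (Sub (k, k) (leqnn k))) `|` Z (inr k)) `|`
  (\big[setU/set0]_(i < n) LTr k i `|` \big[setU/set0]_(ij : 'I_n * 'I_n | ij != (k, k)) LTm k ij).
have mZ e : measurable (Z e) by have [] := entry_eq0_null e.
have mr k i : measurable (LTr k i) by have [] := err_rhs_tail hsigma hLbar1 hbbar1 hLb k i s1.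
have mm k ij : measurable (LTm k ij).
  by have [] := err_mat_tail hsigma hLbar1 hbbar1 hLb k ij.1 ij.2 s1.
have mbad k : measurable (bad k).
  by apply: measurableU; apply: measurableU => //; apply: bigsetU_measurable.
have Pbad k : (P (bad k) <= ((N - 1) * tail_bound sigma s)%:E)%E.
  apply: le_trans (measureU2 _ _ _) _; 
    [exact: measurableU|by apply: measurableU; apply: bigsetU_measurable|].
  rewrite [X in (X + _ <= _)%E](_ : _ = 0%E) ?add0e; last first.
    apply/eqP; rewrite eq_le measure_ge0 andbT.
    apply: le_trans (measureU2 _ _ _) _ => //.
    rewrite [X in (X + _ <= _)%E](entry_eq0_null _).2 add0e.
    by rewrite [X in (X <= _)%E](entry_eq0_null _).2.
  apply: le_trans (measureU2 _ _ _) _; [exact: bigsetU_measurable|exact: bigsetU_measurable|].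
  have -> : (N - 1) * tail_bound sigma s =
      \sum_(i < n) tail_bound sigma s +
      \sum_(ij : 'I_n * 'I_n | ij != (k, k)) tail_bound sigma s.
    rewrite !sumr_const cardC1 card_prod !card_ord -mulrnDr -mulr_natl.
    congr (_ * _); rewrite -subn1 natrD natrB ?muln_gt0 ?hn// natrM /N; ring.
  rewrite EFinD; apply: leeD.
    apply: le_trans (measure_bigsetU_le _ _) _ => //.
    rewrite -sumEFin; apply: lee_sum => i _.
    by have [] := err_rhs_tail hsigma hLbar1 hbbar1 hLb k i s1.
  apply: le_trans (measure_bigsetU_le _ _) _ => //.
  rewrite -sumEFin; apply: lee_sum => ij _.
  by have [] := err_mat_tail hsigma hLbar1 hbbar1 hLb k ij.1 ij.2 s1.
apply: (@le_trans _ _ (P (\big[setU/set0]_(k < n) bad k))).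
  apply: le_measure; rewrite ?inE.
  - rewrite -[X in measurable X]setTI.
    apply: emeasurable_fun_o_infty => //.
    apply: measurable_cond_solve => //; [exact: measurable_L hLb|exact: measurable_b hLb].
  - exact: bigsetU_measurable.
  - move=> w /= tw; rewrite -bigcup_seq/=.
    apply: contrapT => nbad.
    have nb k : ~ bad k w by move=> h; apply: nbad; exists k => //=; rewrite mem_index_enum.
    have diag k : L w k k != 0.
      by apply/eqP => h; apply: (nb k); left; left.
    have uL : L w \in unitmx by rewrite trig_unitmxE//; apply/forallP.
    move: tw; rewrite /cond_solve uL; apply/negP; rewrite -leNgt.
    apply/bigmax_leP; split => [|k _]; first by rewrite lee_fin; lra.
    rewrite leNgt; apply/negP => tk; apply: (nb k).
    have bk : b w k 0 != 0 by apply/eqP => h; apply: (nb k); left; right.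
    right; have t0 : 0 <= t by lra.
    have [[i hi]|[ij ijk hij]] := cond_coord_gt_term (tL w) uL bk sE t0 tk.
      left; rewrite -bigcup_seq; exists i; first by rewrite /= mem_index_enum.
      by rewrite /LTr /large_term /= uL.
    right; rewrite -bigcup_seq_cond; exists ij; first by rewrite /= mem_index_enum.
    by rewrite /LTm /large_term /= uL.
apply: le_trans (measure_bigsetU_le _ _) _ => //.
apply: (@le_trans _ _ (\sum_(k < n) ((N - 1) * tail_bound sigma s)%:E)%E).
  exact: lee_sum.
rewrite sumEFin sumr_const card_ord lee_fin tb -mulr_natl.
by rewrite le_eqVlt; apply/orP; left; apply/eqP; ring.
Qed.

End Tail.

(** * From a tail bound to the expected logarithm *)

Section LogTail.
Context d (T : measurableType d) (R : realType) (P : probability T R).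

Lemma measurable_lne (C : T -> \bar R) :
  measurable_fun setT C -> measurable_fun setT (fun w => lne (C w)).
Proof.
move=> mC; rewrite (_ : (fun _ => _) = (fun w => if (C w <= 0)%E then -oo%E
  else if (+oo <= C w)%E then +oo%E else (ln (fine (C w)))%:E)); last first.
  apply/funext => w; case: (C w) => [r| |] /=; [by []| |by rewrite leNye].
  by rewrite ?lexx ?leye_eq.
apply: measurable_fun_ifT => //; first exact: measurable_fun_lee.
apply: measurable_fun_ifT => //; first exact: measurable_fun_lee.
apply/measurable_EFinP; apply: measurableT_comp => //.
exact: measurableT_comp.
Qed.

(** The layer-cake formula: the integral of the tail of [Y] is at most that of the
exponential density. *)
Lemma integral_exp_tail_le1 (Y : {RV P >-> R}) : (forall w, 0 <= Y w) ->
  (forall u : R, 0 <= u -> (P [set w | (u < Y w)%R] <= (expR (- u))%:E)%E) ->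
  (\int[P]_w (Y w)%:E <= 1)%E.
Proof.
move=> Y0 tail.
have := ge0_expectation_ccdf Y0; rewrite unlock => ->.
have <- := integral_exponential_pdf (ltr01 : 0 < (1 : R)).
have pdf0 x : 0 <= exponential_pdf 1 x :> R by apply: exponential_pdf_ge0.
apply: (@le_trans _ _
  (\int[lebesgue_measure]_(x in `[0%R, +oo[) (exponential_pdf 1 x)%:E)%E); last first.
  apply: ge0_subset_integral => //.
    by apply/measurable_EFinP; exact: measurable_exponential_pdf.
  by move=> x _; rewrite lee_fin.
apply: ge0_le_integral => //.
- by apply: measurable_funTS; exact: ccdf_measurable.
- by apply/measurable_EFinP; apply: measurable_funTS; exact: measurable_exponential_pdf.
- move=> x; rewrite /= in_itv/= andbT => x0.
  rewrite exponential_pdfE// mul1r mulN1r.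
  apply: le_trans (tail x x0).
  rewrite /ccdf /distribution /pushforward.
  rewrite (_ : _ @^-1` _ = [set w | x < Y w])//.
  by apply/seteqP; split => w /=; rewrite in_itv/= andbT.
Qed.

(** At [t0 = N + K] and [u >= 0] the tail bound gives
K / (t0 e^u - N) <= K / ((t0 - N) e^u) = e^-u, which is the tail of an exponential
variable. *)
Lemma integral_loge_tail (C : T -> \bar R) (N K beta : R) :
  measurable_fun setT C -> 0 < K -> 1 <= N + K -> 0 <= N -> 1 < beta ->
  (forall t, N < t -> (P [set w | t%:E < C w] <= (K / (t - N))%:E)%E) ->
  (\int[P]_w loge beta (C w) <= ((ln (N + K) + 1) / ln beta)%:E)%E.
Proof.
move=> mC K0 NK1 N0 beta1 tail; set t0 := N + K.
have lb0 : 0 < ln beta by exact: ln_gt0.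
have t00 : 0 < t0 by exact: lt_le_trans NK1.
have lt0 : 0 <= ln t0 by exact: ln_ge0.
(* [fine] sends +oo to 0, on a set shown to be null below. *)
pose y w := Num.max 0 (ln (fine (C w)) - ln t0).
have my : measurable_fun setT y.
  apply: measurable_maxr => //; apply: measurable_funB => //.
  by apply: measurableT_comp => //; exact: measurableT_comp.
pose Y : {RV P >-> R} := mfun_Sub (mem_set my).
have Y0 w : 0 <= Y w by rewrite /Y/= /y le_max lexx.
have mtail t : measurable [set w | (t%:E < C w)%E].
  by rewrite -[X in measurable X]setTI; apply: emeasurable_fun_o_infty.
have PY : (\int[P]_w (Y w)%:E <= 1)%E.
  apply: integral_exp_tail_le1 => // u u0.
  have eu := expR_gt0 u; have eu1 : 1 <= expR u by rewrite -expR0 ler_expR.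
  have Nt : N < t0 * expR u.
    by apply: (@lt_le_trans _ _ t0); rewrite ?ltrDl// ler_peMr// ltW.
  apply: (@le_trans _ _ (P [set w | (t0 * expR u)%:E < C w]%E)).
    apply: le_measure; rewrite ?inE//.
      rewrite (_ : [set w | _] = Y @^-1` `]u, +oo[); first exact: measurable_funPTI.
      by apply/seteqP; split => w /=; rewrite in_itv/= andbT.
    move=> w /=; rewrite /y lt_max ltNge u0/=.
    case: (C w) => [r| |] /=; [|by rewrite ltry|].
      rewrite lte_fin; have [r0|r0] := leP r 0.
        by rewrite ln0// sub0r ltNge (le_trans _ u0)// oppr_le0.
      rewrite ltrBrDr -ltr_expR expRD !lnK ?posrE//.
      by rewrite mulrC.
    by rewrite ln0// sub0r ltNge (le_trans _ u0)// oppr_le0.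
  apply: le_trans (tail _ Nt) _; rewrite lee_fin expRN.
  rewrite ler_pdivrMr ?subr_gt0// -(ler_pM2l eu) mulrA divff ?gt_eqF// mul1r.
  by rewrite /t0; nra.
(* Let t tend to infinity in the tail bound. *)
have Coo : P [set w | C w = +oo%E] = 0%E.
  have mo : measurable [set w | C w = +oo%E].
    rewrite -[X in measurable X]setTI; apply: (mC measurableT [set +oo%E]).
    exact: emeasurable_set1.
  apply/eqP; rewrite eq_le measure_ge0 andbT; apply/lee_addgt0Pr => e e0.
  rewrite add0e; have Ke : 0 < K / e by rewrite divr_gt0.
  apply: le_trans (_ : P [set w | (N + K / e)%:E < C w]%E <= _)%E.
    apply: le_measure; rewrite ?inE// => w /= ->; exact: ltry.
  apply: le_trans (tail _ _) _; first by rewrite ltrDl.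
  rewrite lee_fin [N + _]addrC addrK invf_div mulrCA divff ?mulr1//.
  by rewrite gt_eqF.
have mf : measurable_fun setT (fun w => loge beta (C w)).
  rewrite /loge inver gt_eqF//; apply: emeasurable_funM => //.
  exact: measurable_lne.
(* The negative part may have infinite integral; only the positive part matters. *)
rewrite integralE.
apply: (@le_trans _ _ (\int[P]_w (fun w => loge beta (C w))^\+ w)%E).
  by rewrite -[X in (_ <= X)%E]sube0; apply: leeB => //; exact: integral_ge0.
apply: (@le_trans _ _ (\int[P]_w ((Y w + ln t0) / ln beta)%:E)%E).
  apply: ae_ge0_le_integral => //.
  - exact: measurable_funepos.
  - move=> w _; rewrite lee_fin; apply: divr_ge0; last exact: ltW.
    exact: addr_ge0.
  - apply/measurable_EFinP; apply: measurable_funM => //.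
    exact: measurable_funD.
  - exists [set w | C w = +oo%E]; split => //.
      rewrite -[X in measurable X]setTI; apply: (mC measurableT [set +oo%E]).
      exact: emeasurable_set1.
    move=> w /= h; apply: contrapT => Cw; apply: h => _.
    rewrite funeposE ge_max; apply/andP; split; last first.
      by rewrite lee_fin; apply: divr_ge0; [exact: addr_ge0|exact: ltW].
    rewrite /loge inver gt_eqF//; move: Cw; rewrite /Y/= /y.
    case: (C w) => [r| |] //= _; last by rewrite mulNyr gtr0_sg ?invr_gt0// mul1e leNye.
    case: ifPn => r0; first by rewrite mulNyr gtr0_sg ?invr_gt0// mul1e leNye.
    rewrite -EFinM lee_fin ler_wpM2r//; first by rewrite invr_ge0 ltW.
    by rewrite -lerBlDr le_max lexx orbT.
under eq_integral do rewrite EFinM EFinD.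
rewrite ge0_integralZr//; last 3 first.
- by apply: emeasurable_funD => //; apply/measurable_EFinP.
- by move=> w _; rewrite -EFinD lee_fin addr_ge0.
- by rewrite lee_fin invr_ge0 ltW.
rewrite ge0_integralD//; last 2 first.
- by move=> w _; rewrite lee_fin.
- by apply/measurable_EFinP.
rewrite integral_cst// [X in (_ + _ * X)%E](_ : _ = 1%E); last exact: probability_setT.
rewrite mule1 EFinM; apply: lee_wpmul2r.
  by rewrite lee_fin invr_ge0 ltW.
by rewrite EFinD [X in (_ <= X)%E]addeC; apply: leeD.
Qed.

End LogTail.

(** * The smoothed analysis *)

Lemma normal_peakE_sqrt (R : realType) (sigma : R) : 0 < sigma ->
  2 * ((1 + sigma) * normal_peak sigma) = (1 + sigma) / sigma * Num.sqrt (2 / pi).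
Proof.
rewrite /normal_peak; move: pi (pi_gt0 R) => p p0 s0.
have r0 : 0 < Num.sqrt (sigma ^+ 2 * p *+ 2).
  by rewrite sqrtr_gt0 pmulrn_lgt0// mulr_gt0// exprn_gt0.
have sq : Num.sqrt (2 / p) * Num.sqrt (sigma ^+ 2 * p *+ 2) = 2 * sigma.
  rewrite -sqrtrM ?divr_ge0 ?ltW//.
  rewrite (_ : 2 / p * (sigma ^+ 2 * p *+ 2) = (2 * sigma) ^+ 2); last first.
    by field; rewrite gt_eqF.
  by rewrite sqrtr_sqr gtr0_norm ?mulr_gt0.
apply: (mulIf (lt0r_neq0 r0)).
rewrite -[RHS]mulrA sq; field.
by rewrite !gt_eqF.
Qed.

Lemma sqrt_2_pi_le1 (R : realType) : Num.sqrt (2 / pi) <= 1 :> R.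
Proof.
rewrite -[X in _ <= X]sqrtr1 ler_wsqrtr// ler_pdivrMr ?pi_gt0// mul1r.
exact: pi_ge2.
Qed.

(** 57/16 <= (1 + 165/400)^4 <= e^(165/100). *)
Lemma ln_57_16_le (R : realType) : ln (57 / 16) <= 165 / 100 :> R.
Proof.
have p0 : 0 < 57 / 16 :> R by lra.
rewrite -[X in _ <= X]expRK ler_ln ?posrE ?expR_gt0//.
have -> : 165 / 100 = 4%:R * (165 / 400) :> R by field.
rewrite expRM_natl.
have h := expR_ge1Dx (165 / 400 : R).
have h0 : 0 <= 1 + 165 / 400 :> R by lra.
apply: (@le_trans _ _ ((1 + 165 / 400) ^+ 4)); first by lra.
by apply: lerXn2r => //; rewrite nnegrE// expR_ge0.
Qed.

Theorem theorem1 (R : realType) (n : nat) (sigma : R)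
    (d : measure_display) (T : measurableType d) (P : probability T R)
    (Lbar : 'M[R]_n) (bbar : 'cV[R]_n)
    (L : T -> 'M[R]_n) (b : T -> 'cV[R]_n)
    (hn : (1 <= n)%N) (hsigma : 0 < sigma)
    (hLbar : is_trig_mx Lbar)
    (hLbar1 : mx_norm Lbar <= 1) (hbbar1 : mx_norm bbar <= 1)
    (hLb : gaussian_triangular P L b Lbar bbar sigma) :
  (forall t : R, n%:R * (n%:R + 1) < t ->
     (P [set w | t%:E < cond_solve (L w) (b w)] <=
      ((1 + sigma) / sigma
        * (n%:R ^+ 3 * (n%:R + 1) ^+ 2 / (t - n%:R * (n%:R + 1)))
        * Num.sqrt (2 / pi))%:E)%E) /\
  (forall beta : R, 1 < beta ->
     (\int[P]_w loge beta (cond_solve (L w) (b w)) <=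
      (logb beta ((1 + sigma) / sigma) + 5 * logb beta n%:R
        + (265 / 100) / ln beta)%:E)%E).
Proof.
have tail := cond_solve_tail hn hsigma hLbar1 hbbar1 hLb.
have n1 : 1 <= n%:R :> R by rewrite ler1n.
set c := Num.sqrt (2 / pi) in tail *; set kappa := (1 + sigma) / sigma.
have c0 : 0 < c by rewrite sqrtr_gt0 divr_gt0 ?pi_gt0.
have c1 : c <= 1 by exact: sqrt_2_pi_le1.
have kappa1 : 1 <= kappa by rewrite ler_pdivlMr// mul1r lerDr.
rewrite normal_peakE_sqrt// -/c -/kappa in tail.
set x : R := n%:R in n1 tail *.
have x0 : 0 < x by exact: lt_le_trans n1.
split => [t Nt|beta beta1].
  apply: le_trans (tail _ Nt) _; rewrite lee_fin.
  rewrite (_ : kappa * _ * c =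
    x * (x * (x + 1)) ^+ 2 * (kappa * c) / (t - x * (x + 1))); last first.
    by field; rewrite gt_eqF// subr_gt0.
  rewrite ler_wpM2r ?invr_ge0 ?subr_ge0 ?(ltW Nt)//.
  rewrite ler_wpM2r//; first by rewrite mulr_ge0 ?(ltW c0)// (le_trans ler01).
  rewrite ler_wpM2l ?(ltW x0)// lerXn2r ?nnegrE//.
  - nra.
  - nra.
  - lra.
set N := x * (x + 1) in tail; set K := x * (N - 1) ^+ 2 * (kappa * c) in tail.
have N2 : 2 <= N by rewrite /N; nra.
have kc0 : 0 < kappa * c by rewrite mulr_gt0// (lt_le_trans ltr01).
have N10 : 0 < N - 1 by lra.
have K0 : 0 < K by rewrite /K pmulr_lgt0// pmulr_rgt0// exprn_gt0.
have mC : measurable_fun setT (fun w => cond_solve (L w) (b w)).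
  have [tL _ _] := hLb.
  by apply: measurable_cond_solve => //; [exact: measurable_L hLb|exact: measurable_b hLb].
apply: le_trans (integral_loge_tail mC K0 _ _ beta1 tail) _; [lra|lra|].
have lb0 : 0 < ln beta by exact: ln_gt0.
rewrite lee_fin /logb mulrA -!mulrDl ler_wpM2r ?invr_ge0 ?(ltW lb0)//.
have NK : N + K <= kappa * x ^+ 5 * (57 / 16).
  have x5 : x ^+ 2 <= x ^+ 5 by apply: ler_weXn2l.
  have hN : N <= 2 * (kappa * x ^+ 5).
    have : x ^+ 5 <= kappa * x ^+ 5 by rewrite ler_peMl// exprn_ge0// ltW.
    by rewrite /N; nra.
  (* Equality at n = 2. *)
  have hN1 : N - 1 <= 5 / 4 * x ^+ 2 by have := sqr_ge0 (x - 2); rewrite /N; nra.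
  have hN2 : (N - 1) ^+ 2 <= 25 / 16 * x ^+ 4.
    rewrite (_ : 25 / 16 * x ^+ 4 = (5 / 4 * x ^+ 2) ^+ 2); last by field.
    by rewrite lerXn2r ?nnegrE//; [lra|rewrite mulr_ge0// sqr_ge0].
  have hK : K <= 25 / 16 * (kappa * x ^+ 5).
    apply: (@le_trans _ _ (x * (25 / 16 * x ^+ 4) * kappa)); last first.
      by rewrite le_eqVlt; apply/orP; left; apply/eqP; field.
    apply: ler_pM; [|exact: ltW| |].
    - by rewrite mulr_ge0 ?sqr_ge0// ltW.
    - by rewrite ler_wpM2l// ltW.
    - by rewrite ler_piMr// (le_trans ler01).
  lra.
have kx0 : 0 < kappa * x ^+ 5 by rewrite mulr_gt0 ?exprn_gt0// (lt_le_trans ltr01).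
have h : ln (N + K) <= ln (kappa * x ^+ 5 * (57 / 16)).
  by rewrite ler_ln ?posrE//; [lra|rewrite mulr_gt0].
apply: le_trans (lerD h (lexx 1)) _.
rewrite lnM ?posrE// lnM ?posrE ?exprn_gt0 ?(lt_le_trans ltr01)// lnXn//.
have := ln_57_16_le R; rewrite -mulr_natl; lra.
Qed.
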